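(* Let $G=G_+G_-$ be a unique factorization of a finite group $G$. (i) An element $R\in H(G;G_+,G_-)\otimes H(G;G_+,G_-)$ is a positive triangular structure if and only if \[ R=\sum_{u,v\in G_+}\{u(\xi(v)^{u})^{-1}\}\otimes\{v\,\xi(u)\} \] for a group homomorphism $\xi:G_+\to G_-$ such that $A_\xi=\{u\xi(u^{-1}):u\in G_+\}$ is an abelian normal subgroup of $G$; $\xi$ is uniquely determined by $R$. (ii) For a group homomorphism $\xi:G_+\to G_-$, $A_\xi$ is an abelian normal subgroup of $G$ if and only if $uv=({}^{\xi(u)}v)(u^{\xi(v)})$ and $\xi({}^x u)\,x^u=x\,\xi(u)$ for all $u,v\in G_+$, $x\in G_-$. (iii) Pairs $(G=G_+G_-,\xi)$ as in (ii) correspond one-to-one to triples $(G_-,A,\zeta)$ consisting of a finite group $G_-$, a finite abelian group $A$ on which $G_-$ acts by automorphisms, and a 1-cycle $\zeta:A\to G_-$: given $(G=G_+G_-,\xi)$ take $A=A_\xi$ with $G_-$ acting by conjugation and $\zeta(u\xi(u^{-1}))=\xi(u)$; given $(G_-,A,\zeta)$ take $G=A\rtimes G_-$, $G_+=\{a\zeta(a):a\in A\}$, and $\xi=P|_{G_+}$ where $P:A\rtimes G_-\to G_-$, $ax\mapsto x$. These constructions are well defined and mutually inverse (identifying $G$ with $A_\xi\rtimes G_-$ via $(a,x)\mapsto ax$).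
   Context: A unique factorization $G=G_+G_-$ consists of subgroups $G_+,G_-$ with every $g\in G$ uniquely $g=g_+g_-$, $g_+\in G_+$, $g_-\in G_-$. For $u\in G_+$, $x\in G_-$ define ${}^u x\in G_-$, $u^x\in G_+$, ${}^x u\in G_+$, $x^u\in G_-$ by $ux=({}^u x)(u^x)$ and $xu=({}^x u)(x^u)$. $H(G;G_+,G_-)$ is the complex vector space with basis $\{g\}$, $g\in G$, and Hopf algebra structure $\{g\}\{h\}=\delta_{g_+^{\,g_-},\,h_+}\{g h_-\}$, $1=\sum_{u\in G_+}\{u\}$, $\Delta\{g\}=\sum_{h\in G_+}\{g_+h^{-1}({}^{h}g_-)\}\otimes\{h g_-\}$, $\varepsilon\{g\}=\delta_{g_+,e}$, $S\{g\}=\{g^{-1}\}$. A quasi-triangular structure on a Hopf algebra $H$ is an invertible $R\in H\otimes H$ with $\tau\Delta(a)=R\Delta(a)R^{-1}$ for all $a$ ($\tau$ the flip), $(\Delta\otimes\mathrm{id})R=R_{13}R_{23}$, $(\mathrm{id}\otimes\Delta)R=R_{13}R_{12}$, $(\varepsilon\otimes\mathrm{id})R=(\mathrm{id}\otimes\varepsilon)R=1$; it is triangular if moreover $(\tau R)R=1\otimes1$. It is positive if it is a linear combination of the $\{g\}\otimes\{h\}$ with non-negative real coefficients. If $G_-$ acts on $A$ by automorphisms $(x,a)\mapsto x\cdot a$, then $A\rtimes G_-$ has product $(ax)(by)=a(x\cdot b)xy$, and $\zeta:A\to G_-$ is a 1-cycle if $\zeta(a)\zeta(b)=\zeta(a(\zeta(a)\cdot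 b))$ for all $a,b\in A$. (The paper phrases item (i) as data ''a finite dimensional Hopf algebra with a positive basis and a positive triangular structure''; such Hopf algebras are, by the authors' earlier work, of the form $H(G;G_+,G_-)$ with basis $G$.) *)

(* Defs.v *)
From HB Require Import structures.
From mathcomp Require Import all_boot all_order all_algebra all_fingroup.
From mathcomp Require Import complex Rstruct.

Set Implicit Arguments.
Unset Strict Implicit.
Unset Printing Implicit Defensive.

Import GRing.Theory Num.Theory.

Notation CC := (complex Rdefinitions.R).

Local Open Scope group_scope.

Section Factorizations.
Variable gT : finGroupType.

Definition unique_factorization (Gp Gm : {set gT}) : Prop :=
  forall g : gT, exists! p : gT * gT, [/\ p.1 \in Gp, p.2 \in Gm & g = p.1 * p.2].

Definition fact2 (H K : {set gT}) (g : gT) : gT * gT :=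
  odflt (1, 1) [pick p : gT * gT | [&& p.1 \in H, p.2 \in K & g == p.1 * p.2]].

Variables Gp Gm : {set gT}.

Definition gplus (g : gT) : gT := (fact2 Gp Gm g).1.
Definition gminus (g : gT) : gT := (fact2 Gp Gm g).2.

(* For u in G+, x in G-:  u x = (^u x)(u^x),  ^u x in G-, u^x in G+. *)
Definition mp_lact (u x : gT) : gT := (fact2 Gm Gp (u * x)).1.
Definition mp_ract (u x : gT) : gT := (fact2 Gm Gp (u * x)).2.
(* For x in G-, u in G+:  x u = (^x u)(x^u),  ^x u in G+, x^u in G-. *)
Definition pm_lact (x u : gT) : gT := (fact2 Gp Gm (x * u)).1.
Definition pm_ract (x u : gT) : gT := (fact2 Gp Gm (x * u)).2.

(* The Hopf algebra H = H(G;G+,G-) over CC with basis {g}, g in G.    *)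
(* An element of H is its coefficient function gT -> CC; elements of  *)
(* H (x) H and H (x) H (x) H are coefficient functions on gT*gT and   *)
(* gT*gT*gT (coefficient of {g}(x){h}, resp. {g}(x){h}(x){k}).        *)

Definition delta (b : bool) : CC := (b%:R)%R.

(* {g}{h} = delta_{g+^{g-}, h+} {g h-}: coefficient of {k} in {g}{h} *)
Definition mulc (g h k : gT) : CC :=
  delta ((mp_ract (gplus g) (gminus g) == gplus h) && (k == g * gminus h)).

(* coefficient of {k1}(x){k2} in
   Delta{g} = sum_{h in G+} {g+ h^-1 (^h g-)} (x) {h g-} *)
Definition coprodc (g k1 k2 : gT) : CC :=
  (\sum_(h in Gp) delta ((k1 == (gplus g * h^-1 * mp_lact h (gminus g))%g)
                        && (k2 == (h * gminus g)%g)))%R.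

Definition counitc (g : gT) : CC := delta (gplus g == 1).

Definition hmul (a b : {ffun gT -> CC}) : {ffun gT -> CC} :=
  [ffun k => (\sum_g \sum_h a g * b h * mulc g h k)%R].
Definition hone : {ffun gT -> CC} := [ffun k => delta (k \in Gp)].

Definition hcoprod (a : {ffun gT -> CC}) : {ffun gT * gT -> CC} :=
  [ffun k => (\sum_g a g * coprodc g k.1 k.2)%R].

Definition t2mul (a b : {ffun gT * gT -> CC}) : {ffun gT * gT -> CC} :=
  [ffun k => (\sum_p \sum_q a p * b q * mulc p.1 q.1 k.1 * mulc p.2 q.2 k.2)%R].
Definition t2one : {ffun gT * gT -> CC} :=
  [ffun k => delta ((k.1 \in Gp) && (k.2 \in Gp))].

Definition t3mul (a b : {ffun gT * gT * gT -> CC}) : {ffun gT * gT * gT -> CC} :=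
  [ffun k => (\sum_p \sum_q a p * b q * mulc p.1.1 q.1.1 k.1.1
                 * mulc p.1.2 q.1.2 k.1.2 * mulc p.2 q.2 k.2)%R].

Definition flip2 (a : {ffun gT * gT -> CC}) : {ffun gT * gT -> CC} :=
  [ffun k => a (k.2, k.1)].

Definition coprod_id (R : {ffun gT * gT -> CC}) : {ffun gT * gT * gT -> CC} :=
  [ffun k => (\sum_p R p * coprodc p.1 k.1.1 k.1.2 * delta (k.2 == p.2))%R].
Definition id_coprod (R : {ffun gT * gT -> CC}) : {ffun gT * gT * gT -> CC} :=
  [ffun k => (\sum_p R p * delta (k.1.1 == p.1) * coprodc p.2 k.1.2 k.2)%R].

(* R_12, R_13, R_23 (the unit 1 = sum_{u in G+} {u} inserted) *)
Definition R12 (R : {ffun gT * gT -> CC}) : {ffun gT * gT * gT -> CC} :=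
  [ffun k => R (k.1.1, k.1.2) * delta (k.2 \in Gp)]%R.
Definition R13 (R : {ffun gT * gT -> CC}) : {ffun gT * gT * gT -> CC} :=
  [ffun k => R (k.1.1, k.2) * delta (k.1.2 \in Gp)]%R.
Definition R23 (R : {ffun gT * gT -> CC}) : {ffun gT * gT * gT -> CC} :=
  [ffun k => delta (k.1.1 \in Gp) * R (k.1.2, k.2)]%R.

Definition counit_id (R : {ffun gT * gT -> CC}) : {ffun gT -> CC} :=
  [ffun h => (\sum_p R p * counitc p.1 * delta (h == p.2))%R].
Definition id_counit (R : {ffun gT * gT -> CC}) : {ffun gT -> CC} :=
  [ffun g => (\sum_p R p * delta (g == p.1) * counitc p.2)%R].

Definition quasitriangular (R : {ffun gT * gT -> CC}) : Prop :=
  [/\ exists Ri : {ffun gT * gT -> CC},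
        [/\ t2mul R Ri = t2one, t2mul Ri R = t2one &
            forall a : {ffun gT -> CC},
              flip2 (hcoprod a) = t2mul (t2mul R (hcoprod a)) Ri],
      coprod_id R = t3mul (R13 R) (R23 R),
      id_coprod R = t3mul (R13 R) (R12 R),
      counit_id R = hone &
      id_counit R = hone].

Definition triangular (R : {ffun gT * gT -> CC}) : Prop :=
  quasitriangular R /\ t2mul (flip2 R) R = t2one.

Definition positive (R : {ffun gT * gT -> CC}) : Prop :=
  forall p, (0 <= R p)%R.

Definition grp_hom_on (xi : gT -> gT) : Prop :=
  {in Gp &, forall u v, xi (u * v) = xi u * xi v} /\ {in Gp, forall u, xi u \in Gm}.

Definition A_xi (xi : gT -> gT) : {set gT} := [set u * xi u^-1 | u in Gp].

Definition abelian_normal_subgroup (A : {set gT}) : bool :=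
  [&& group_set A, abelian A & A <| [set: gT]].

Definition R_of_xi (xi : gT -> gT) : {ffun gT * gT -> CC} :=
  [ffun k => (\sum_(u in Gp) \sum_(v in Gp)
                delta (k == ((u * (pm_ract (xi v) u)^-1)%g, (v * xi u)%g)))%R].

Definition matched_condition (xi : gT -> gT) : Prop :=
  forall u v x, u \in Gp -> v \in Gp -> x \in Gm ->
    u * v = pm_lact (xi u) v * mp_ract u (xi v) /\
    xi (pm_lact x u) * pm_ract x u = x * xi u.

Definition good_pair (xi : gT -> gT) : Prop :=
  [/\ unique_factorization Gp Gm, grp_hom_on xi & abelian_normal_subgroup (A_xi xi)].

End Factorizations.

(* triples (G-, A, zeta).  G- is a group Gm in a finGroupType xT, A an *)
(* abelian group in rT, the action of G- on A by automorphisms is a    *)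
(* MathComp (right) groupAction  to  of Gm on A; the paper's left      *)
(* action is  x . a := to a x^-1.                                       *)

Section Triples.
Variables (xT rT : finGroupType) (Gm : {group xT}) (A : {group rT}).
Variable to : groupAction Gm A.

Definition ldot (x : xT) (a : rT) : rT := to a x^-1.

Definition one_cycle (zeta : rT -> xT) : Prop :=
  {in A &, forall a b, zeta a * zeta b = zeta (a * ldot (zeta a) b)}.

Definition good_triple (zeta : rT -> xT) : Prop :=
  [/\ abelian A, {in A, forall a, zeta a \in Gm} & one_cycle zeta].

(* A x| G- is  sdprod_by to ; the paper's element  a x  (a in A, x in G-)
   is  sdpair1 to a * sdpair2 to x. *)
Definition sdGp (zeta : rT -> xT) : {set sdprod_by to} :=
  [set sdpair1 to a * sdpair2 to (zeta a) | a in A].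
Definition sdGm : {set sdprod_by to} := [set sdpair2 to x | x in Gm].
(* P : A x| G- -> G-,  a x |-> x   (w = sdpair2 w.1 * sdpair1 w.2 = (w.1 . w.2) w.1) *)
Definition sdP (w : sdprod_by to) : sdprod_by to := sdpair2 to (val w).1.

End Triples.

Arguments sdP {xT rT Gm A} to w.
Arguments sdGp {xT rT Gm A} to zeta.
Arguments sdGm {xT rT Gm A} to.
Arguments ldot {xT rT Gm A} to x a.
Arguments good_triple {xT rT Gm A} to zeta.

(* Main.v *)
Require Import Defs.
From HB Require Import structures.
From mathcomp Require Import all_boot all_order all_algebra all_fingroup.
From mathcomp Require Import complex Rstruct.
From mathcomp Require Import ring.

(** [H(G;G+,G-)] is the algebra of the groupoid with objects [G+] and an arrow
    [u x : u -> u^x] for [u] in [G+], [x] in [G-].  A positive triangular [R] and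
    its inverse [tau R] are both non-negative, so no cancellation can happen and
    [R] has exactly one arrow [(u a(u,v), v b(u,v))], with a coefficient [c(u,v)],
    out of each object [(u,v)].  The coproduct axioms make [b(u,v) = xi(u)] a
    homomorphism and determine [a] from [a(1,v)]; triangularity gives
    [a(1,v) = xi(v)^-1]; and [tau Delta = R Delta R^-1] yields the two identities
    of (ii) together with the invariance of [c] under [G-], which forces [c = 1].
    The same identities, read backwards, verify the axioms.

    The second identity of (ii) says that conjugation by [x] in [G-] sends
    [u xi(u)^-1] to [(^x u) xi(^x u)^-1]; the first one then amounts to
    commutativity of [A_xi]. *)

(** * From triples to factorizations: the semidirect product *)

Section Triple.
Local Open Scope group_scope.
Variables (xT rT : finGroupType) (Gm : {group xT}) (A : {group rT}).
Variables (to : groupAction Gm A) (zeta : rT -> xT).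

Local Notation s1 := (sdpair1 to).
Local Notation s2 := (sdpair2 to).

(** [sdpair_act] turns the right action into right conjugation; the inverse in [ldot] makes it a
    left action by left conjugation. *)
Lemma sdpair1_ldot : {in A & Gm, forall a x,
  s1 (ldot to x a) = (s2 x * s1 a * (s2 x)^-1)}.
Proof.
move=> a x Ha Hx; rewrite /ldot sdpair_act ?groupV // morphV // conjgE invgK.
by rewrite mulgA.
Qed.

Lemma ldot_stable a x : a \in A -> x \in Gm -> ldot to x a \in A.
Proof. by move=> Ha Hx; rewrite /ldot gact_stable ?groupV. Qed.

Lemma sdpair12M a x b y : a \in A -> x \in Gm -> b \in A -> y \in Gm ->
  s1 a * s2 x * (s1 b * s2 y) = s1 (a * ldot to x b) * s2 (x * y).
Proof.
move=> Ha Hx Hb Hy; rewrite sdpair1_morphM ?ldot_stable // sdpair2_morphM // sdpair1_ldot //.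
by rewrite !mulgA mulgKV.
Qed.

Lemma sdpair12_ex (w : sdprod_by to) :
  exists a x, [/\ a \in A, x \in Gm & w = s1 a * s2 x].
Proof.
have [Hx Ha] : (val w).1 \in Gm /\ (val w).2 \in A.
  by case: w => [[x a] /= /setXP].
exists (ldot to (val w).1 (val w).2), (val w).1; split; rewrite ?ldot_stable //.
by rewrite sdpair1_ldot // mulgKV; apply: sdpairE.
Qed.

Lemma sdP_pair a x : a \in A -> x \in Gm -> sdP to (s1 a * s2 x) = s2 x.
Proof.
by move=> Ha Hx; rewrite /sdP /= !val_insubd !inE !group1 Ha Hx /= mul1g.
Qed.

Lemma sdpair12_inj a x b y : a \in A -> x \in Gm -> b \in A -> y \in Gm ->
  s1 a * s2 x = s1 b * s2 y -> a = b /\ x = y.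
Proof.
move=> Ha Hx Hb Hy e; have := congr1 (sdP to) e; rewrite !sdP_pair // => e2.
have ex : x = y by apply: (injmP (injm_sdpair2 to)).
split=> //; apply: (injmP (injm_sdpair1 to)) => //.
by apply: (mulIg (s2 x)); rewrite e ex.
Qed.

Hypothesis gt : good_triple to zeta.

Lemma zetaG a : a \in A -> zeta a \in Gm.
Proof. by case: gt => _ + _; apply. Qed.

Lemma zetaM a b : a \in A -> b \in A ->
  zeta a * zeta b = zeta (a * ldot to (zeta a) b).
Proof. by case: gt => _ _; apply. Qed.

Lemma zeta1 : zeta 1 = 1.
Proof.
have := zetaM 1 1 (group1 _) (group1 _).
rewrite mul1g /ldot gact1 ?groupV ?zetaG // => e.
by apply: (mulgI (zeta 1)); rewrite mulg1.
Qed.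

(** The 1-cycle identity is exactly closure under products: the [G-] part [zeta a * zeta b] of a
    product must be [zeta] of its [A] part. *)
Lemma sdGp_group : group_set (sdGp to zeta).
Proof.
apply/group_setP; split.
  by apply/imsetP; exists 1; rewrite // zeta1 !morph1 mulg1.
move=> _ _ /imsetP[a Ha ->] /imsetP[b Hb ->]; apply/imsetP.
exists (a * ldot to (zeta a) b); first by rewrite groupM ?ldot_stable ?zetaG.
by rewrite sdpair12M ?zetaG // zetaM.
Qed.

Lemma sdPM w w' : sdP to (w * w') = sdP to w * sdP to w'.
Proof.
have [a [x [Ha Hx ->]]] := sdpair12_ex w.
have [b [y [Hb Hy ->]]] := sdpair12_ex w'.
by rewrite sdpair12M // !sdP_pair ?groupM ?ldot_stable // sdpair2_morphM.
Qed.

Lemma sdPV w : sdP to w^-1 = (sdP to w)^-1.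
Proof.
apply: (mulIg (sdP to w)); rewrite -sdPM !mulVg.
by apply: (mulgI (sdP to 1)); rewrite -sdPM !mulg1.
Qed.

Lemma A_xi_sd : A_xi (sdGp to zeta) (sdP to) = [set s1 a | a in A].
Proof.
have E a : a \in A ->
    s1 a * s2 (zeta a) * sdP to (s1 a * s2 (zeta a))^-1 = s1 a.
  by move=> Ha; rewrite sdPV sdP_pair ?zetaG // mulgK.
apply/setP=> w; apply/imsetP/imsetP => [[_ /imsetP[a Ha ->] ->] | [a Ha ->]].
  by exists a; rewrite ?E.
by exists (s1 a * s2 (zeta a)); rewrite ?E //; apply/imsetP; exists a.
Qed.

Lemma sd_good_pair : good_pair (sdGp to zeta) (sdGm to) (sdP to).
Proof.
split.
- move=> w; have [a [x [Ha Hx ->]]] := sdpair12_ex w.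
  (* The [A] part [a] fixes the [G+] factor [a zeta(a)], and the [G-] factor is what remains of
     [x]. *)
  exists (s1 a * s2 (zeta a), s2 ((zeta a)^-1 * x)); split=> /=.
    have Hz := zetaG _ Ha.
    split; first by apply/imsetP; exists a.
      by apply/imsetP; exists ((zeta a)^-1 * x); rewrite ?groupM ?groupV.
    by rewrite -mulgA -sdpair2_morphM ?groupM ?groupV // mulKVg.
  move=> [_ _] /= [/imsetP[b Hb ->] /imsetP[y Hy ->]].
  rewrite -mulgA -sdpair2_morphM ?zetaG //.
  case/sdpair12_inj; rewrite ?groupM ?zetaG // => -> ->.
  by rewrite mulKg.
- split=> [w w' _ _ | w _]; first exact: sdPM.
  have [a [x [Ha Hx ->]]] := sdpair12_ex w.
  by rewrite sdP_pair //; apply/imsetP; exists x.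
have EA : A_xi (sdGp to zeta) (sdP to) = s1 @* A.
  by rewrite A_xi_sd morphimE setIid.
rewrite /abelian_normal_subgroup EA groupP /=; apply/andP; split.
  by rewrite morphim_abelian //; case: gt.
by case/sdprod_context: (sdprod_sdpair to).
Qed.

Lemma sd_zeta (zeta' : sdprod_by to -> sdprod_by to) :
  {in sdGp to zeta, forall u, zeta' (u * sdP to u^-1)%g = sdP to u} ->
  {in A, forall a, zeta' (s1 a) = s2 (zeta a)}.
Proof.
move=> H a Ha; have := H (s1 a * s2 (zeta a)).
rewrite sdPV sdP_pair ?zetaG // mulgK; apply.
by apply/imsetP; exists a.
Qed.
End Triple.

(** * The two pairs of actions attached to a unique factorization *)

Section MatchedPair.
Local Open Scope group_scope.

Variables (gT : finGroupType) (Gp Gm : {group gT}).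
Hypothesis uf : unique_factorization Gp Gm.

Local Notation la := (mp_lact Gp Gm).
Local Notation ra := (mp_ract Gp Gm).
Local Notation pla := (pm_lact Gp Gm).
Local Notation pra := (pm_ract Gp Gm).

Local Ltac gsimp :=
  rewrite ?(invMg, mulgA, mulgK, mulgKV, mulVg, mulgV, mul1g, mulg1, invgK, invg1).

Lemma uf_pm g : exists u x, [/\ u \in Gp, x \in Gm & g = u * x].
Proof. by have [[u x] [[/= Hu Hx ->] _]] := uf g; exists u, x. Qed.

Lemma uf_mp g : exists x u, [/\ x \in Gm, u \in Gp & g = x * u].
Proof.
have [u [x [Hu Hx e]]] := uf_pm g^-1.
by exists x^-1, u^-1; rewrite !groupV -invMg -e invgK.
Qed.

Lemma uf_inj u x u' x' : u \in Gp -> x \in Gm -> u' \in Gp -> x' \in Gm ->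
  u * x = u' * x' -> u = u' /\ x = x'.
Proof.
move=> Hu Hx Hu' Hx' e; have [p [_ Up]] := uf (u * x).
have /= E1 := Up (u, x) (And3 Hu Hx erefl).
have /= E2 := Up (u', x') (And3 Hu' Hx' e).
by move: E2; rewrite E1 => -[-> ->].
Qed.

Lemma uf_mp_inj u x u' x' : u \in Gp -> x \in Gm -> u' \in Gp -> x' \in Gm ->
  x * u = x' * u' -> x = x' /\ u = u'.
Proof.
move=> Hu Hx Hu' Hx' e.
have [] := @uf_inj u^-1 x^-1 u'^-1 x'^-1; rewrite ?groupV // -?invMg ?e //.
by move=> /invg_inj -> /invg_inj ->.
Qed.

(** The quotient [x^-1 * x' = u^-1 * u'] lies in both subgroups, hence is trivial. This compares
    labels in [Gm] when the factors in [Gp] are not yet known to agree. *)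
Lemma uf_mp_eqm q x x' u u' : q \in Gp -> x \in Gm -> x' \in Gm -> u \in Gp ->
  u' \in Gp -> forall g, q * x = g * u -> q * x' = g * u' -> x = x'.
Proof.
move=> Hq Hx Hx' Hu Hu' g e e'.
have E : x^-1 * x' = u^-1 * u'.
  by rewrite (canRL (mulKg q) e) (canRL (mulKg q) e'); gsimp.
have [|||||_ E'] := @uf_inj 1 (x^-1 * x') (u^-1 * u') 1; rewrite ?groupM ?groupV ?group1 //.
  by rewrite E mul1g mulg1.
by rewrite -[x']mul1g -(mulgV x) -mulgA E' mulg1.
Qed.

Lemma fact2_pm u x : u \in Gp -> x \in Gm -> fact2 Gp Gm (u * x) = (u, x).
Proof.
move=> Hu Hx; rewrite /fact2; case: pickP => [[v y] /= /and3P[Hv Hy /eqP e] | /(_ (u, x))].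
  by have [-> ->] := uf_inj _ _ _ _ Hu Hx Hv Hy e.
by rewrite /= Hu Hx eqxx.
Qed.

Lemma fact2_mp u x : u \in Gp -> x \in Gm -> fact2 Gm Gp (x * u) = (x, u).
Proof.
move=> Hu Hx; rewrite /fact2; case: pickP => [[y v] /= /and3P[Hy Hv /eqP e] | /(_ (x, u))].
  by have [-> ->] := uf_mp_inj _ _ _ _ Hu Hx Hv Hy e.
by rewrite /= Hu Hx eqxx.
Qed.

Lemma gplusE u x : u \in Gp -> x \in Gm -> gplus Gp Gm (u * x) = u.
Proof. by move=> Hu Hx; rewrite /gplus fact2_pm. Qed.

Lemma gminusE u x : u \in Gp -> x \in Gm -> gminus Gp Gm (u * x) = x.
Proof. by move=> Hu Hx; rewrite /gminus fact2_pm. Qed.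

Lemma mp_act u x : u \in Gp -> x \in Gm ->
  [/\ la u x \in Gm, ra u x \in Gp & u * x = la u x * ra u x].
Proof.
move=> Hu Hx; have [y [v [Hy Hv e]]] := uf_mp (u * x).
by rewrite /mp_lact /mp_ract e fact2_mp.
Qed.

Lemma pm_act x u : x \in Gm -> u \in Gp ->
  [/\ pla x u \in Gp, pra x u \in Gm & x * u = pla x u * pra x u].
Proof.
move=> Hx Hu; have [v [y [Hv Hy e]]] := uf_pm (x * u).
by rewrite /pm_lact /pm_ract e fact2_pm.
Qed.

Lemma mp_actE u x y v : y \in Gm -> v \in Gp ->
  u * x = y * v -> la u x = y /\ ra u x = v.
Proof. by move=> Hy Hv e; rewrite /mp_lact /mp_ract e fact2_mp. Qed.

Lemma pm_actE u x y v : y \in Gm -> v \in Gp ->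
  x * u = v * y -> pla x u = v /\ pra x u = y.
Proof. by move=> Hy Hv e; rewrite /pm_lact /pm_ract e fact2_pm. Qed.

Lemma mp_la u x : u \in Gp -> x \in Gm -> la u x \in Gm.
Proof. by move=> Hu Hx; have [] := mp_act _ _ Hu Hx. Qed.

Lemma mp_ra u x : u \in Gp -> x \in Gm -> ra u x \in Gp.
Proof. by move=> Hu Hx; have [] := mp_act _ _ Hu Hx. Qed.

Lemma mp_swap u x : u \in Gp -> x \in Gm -> u * x = la u x * ra u x.
Proof. by move=> Hu Hx; have [] := mp_act _ _ Hu Hx. Qed.

Lemma mp_1r u : u \in Gp -> la u 1 = 1 /\ ra u 1 = u.
Proof. by move=> Hu; apply: mp_actE; rewrite ?group1 // mulg1 mul1g. Qed.

Lemma mp_Mr u x y : u \in Gp -> x \in Gm -> y \in Gm ->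
  la u (x * y) = la u x * la (ra u x) y /\ ra u (x * y) = ra (ra u x) y.
Proof.
move=> Hu Hx Hy; apply: mp_actE; rewrite ?(groupM, mp_la, mp_ra) //.
by rewrite mulgA (mp_swap u x) // -mulgA (mp_swap (ra u x)) ?mp_ra // mulgA.
Qed.

Lemma mp_Ml u v x : u \in Gp -> v \in Gp -> x \in Gm ->
  la (u * v) x = la u (la v x) /\ ra (u * v) x = ra u (la v x) * ra v x.
Proof.
move=> Hu Hv Hx; apply: mp_actE; rewrite ?(groupM, mp_la, mp_ra) //.
by rewrite -mulgA (mp_swap v x) // mulgA (mp_swap u) ?mp_la // mulgA.
Qed.

Lemma pm_pla x u : x \in Gm -> u \in Gp -> pla x u \in Gp.
Proof. by move=> Hx Hu; have [] := pm_act _ _ Hx Hu. Qed.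

Lemma pm_pra x u : x \in Gm -> u \in Gp -> pra x u \in Gm.
Proof. by move=> Hx Hu; have [] := pm_act _ _ Hx Hu. Qed.

Lemma pm_swap x u : x \in Gm -> u \in Gp -> x * u = pla x u * pra x u.
Proof. by move=> Hx Hu; have [] := pm_act _ _ Hx Hu. Qed.

Lemma pra_M x u v : x \in Gm -> u \in Gp -> v \in Gp ->
  pra x (u * v) = pra (pra x u) v.
Proof.
move=> Hx Hu Hv.
have [] // := pm_actE (u * v) x (pra (pra x u) v) (pla x u * pla (pra x u) v).
- by rewrite !pm_pra.
- by rewrite groupM ?pm_pla ?pm_pra.
by rewrite mulgA (pm_swap x u) // -mulgA (pm_swap (pra x u)) ?pm_pra // mulgA.
Qed.

Lemma pra_Ml x y u : x \in Gm -> y \in Gm -> u \in Gp ->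
  pra (x * y) u = pra x (pla y u) * pra y u.
Proof.
move=> Hx Hy Hu.
have [] // := pm_actE u (x * y) (pra x (pla y u) * pra y u) (pla x (pla y u)).
- by rewrite groupM ?pm_pla ?pm_pra ?pm_pla.
- by rewrite !pm_pla.
by rewrite -mulgA (pm_swap y u) // mulgA (pm_swap x) ?pm_pla // mulgA.
Qed.

Lemma pla_pla x u : x \in Gm -> u \in Gp -> pla x (pla x^-1 u) = u.
Proof.
move=> Hx Hu; have Hx' : x^-1 \in Gm by rewrite groupV.
have [] // := pm_actE (pla x^-1 u) x (pra x^-1 u)^-1 u; first by rewrite groupV pm_pra.
by apply: (mulgI x^-1); rewrite mulKg mulgA (pm_swap x^-1 u) // mulgK.
Qed.

(** * Item (ii): the group [A_xi] and the two matching identities *)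

Section Homomorphism.
Variable xi : gT -> gT.
Hypothesis hxi : grp_hom_on Gp Gm xi.

Lemma xiM u v : u \in Gp -> v \in Gp -> xi (u * v) = xi u * xi v.
Proof. by move=> Hu Hv; apply: hxi.1. Qed.

Lemma xiG u : u \in Gp -> xi u \in Gm.
Proof. exact: hxi.2. Qed.

Lemma xi1 : xi 1 = 1.
Proof.
have := xiM 1 1 (group1 _) (group1 _); rewrite mulg1 => e.
by apply: (mulgI (xi 1)); rewrite mulg1.
Qed.

Lemma xiV u : u \in Gp -> xi u^-1 = (xi u)^-1.
Proof.
by move=> Hu; apply: (mulIg (xi u)); rewrite -xiM ?groupV // !mulVg xi1.
Qed.

Lemma A_xiP g :
  reflect (exists2 u, u \in Gp & g = u * (xi u)^-1) (g \in A_xi Gp xi).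
Proof.
by apply: (iffP imsetP) => [] [u Hu ->]; exists u; rewrite ?xiV.
Qed.

Lemma A_xi_mem u : u \in Gp -> u * (xi u)^-1 \in A_xi Gp xi.
Proof. by move=> Hu; apply/A_xiP; exists u. Qed.

Section Matched.
Hypothesis mc : matched_condition Gp Gm xi.

(** The second identity in a form that applies to any commuting square [x * u = u' * x'], whichever
    of the actions produced it. *)
Lemma mc_conj x u x' u' : x \in Gm -> u \in Gp -> x' \in Gm -> u' \in Gp ->
  x * u = u' * x' -> xi u' * x' = x * xi u.
Proof.
move=> Hx Hu Hx' Hu' e; have [_] := mc u 1 x Hu (group1 _) Hx.
by have [-> ->] := pm_actE _ _ _ _ Hx' Hu' e.
Qed.

Lemma mc_braid u v : u \in Gp -> v \in Gp -> u * v = pla (xi u) v * ra u (xi v).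
Proof. by move=> Hu Hv; have [] := mc u v 1 Hu Hv (group1 _). Qed.

(** The product [xi u * xi v] is computed twice, by applying [xi] to the first identity and by
    [mc_conj] on the square [u * xi v = la * ra]; the common right factor cancels. *)
Lemma la_xi u v : u \in Gp -> v \in Gp -> la u (xi v) = xi (pla (xi u) v).
Proof.
move=> Hu Hv; have [Hl Hr e] := mp_act _ _ Hu (xiG _ Hv).
have [Hpl Hpr e'] := pm_act _ _ (xiG _ Hu) Hv.
have E : xi u * xi v = xi (pla (xi u) v) * xi (ra u (xi v)).
  by rewrite -!xiM // mc_braid.
have := mc_conj (la u (xi v)) (ra u (xi v)) (xi v) u Hl Hr (xiG _ Hv) Hu (esym e).
by rewrite E => /mulIg.
Qed.

(** As for [la_xi], with the square [xi u * v = pla * pra] and cancellation on the left. *)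
Lemma xi_ra u v : u \in Gp -> v \in Gp -> xi (ra u (xi v)) = pra (xi u) v.
Proof.
move=> Hu Hv; have [Hl Hr e] := mp_act _ _ Hu (xiG _ Hv).
have [Hpl Hpr e'] := pm_act _ _ (xiG _ Hu) Hv.
have E : xi u * xi v = xi (pla (xi u) v) * xi (ra u (xi v)).
  by rewrite -!xiM // mc_braid.
have := mc_conj _ _ _ _ (xiG _ Hu) Hv Hpr Hpl e'.
by rewrite E => /mulgI ->.
Qed.

Lemma A_conj x u : x \in Gm -> u \in Gp ->
  x * (u * (xi u)^-1) * x^-1 = pla x u * (xi (pla x u))^-1.
Proof.
move=> Hx Hu; have [Hl Hr e] := pm_act _ _ Hx Hu.
have e' := mc_conj _ _ _ _ Hx Hu Hr Hl e.
by rewrite mulgA e -!mulgA -invMg -e'; gsimp.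
Qed.

(** The second factor is the conjugate of [v * (xi v)^-1] by [xi u], so the inner [xi u] cancels. *)
Lemma A_mul u v : u \in Gp -> v \in Gp ->
  (u * (xi u)^-1) * (pla (xi u) v * (xi (pla (xi u) v))^-1)
  = (u * v) * (xi (u * v))^-1.
Proof.
by move=> Hu Hv; rewrite -A_conj ?xiG // xiM //; gsimp.
Qed.

Lemma matched_abelian_normal : abelian_normal_subgroup (A_xi Gp xi).
Proof.
have AG : group_set (A_xi Gp xi).
  apply/group_setP; split.
    by apply/A_xiP; exists 1; rewrite ?group1 // xi1 mul1g invg1.
  move=> _ _ /A_xiP[u Hu ->] /A_xiP[v Hv ->].
  (* Since [pla (xi u)] is onto [Gp], every second factor has the form that [A_mul] requires. *)
  rewrite -(pla_pla (xi u) v) ?xiG //.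
  have Hw : pla (xi u)^-1 v \in Gp by rewrite pm_pla ?groupV ?xiG.
  move: (pla _ v) Hw => w Hw.
  by rewrite A_mul // A_xi_mem // groupM.
apply/and3P; split=> //.
  apply/centsP => _ /A_xiP[u Hu ->] _ /A_xiP[v Hv ->].
  rewrite -(pla_pla (xi u) v) ?xiG //.
  have Hw : pla (xi u)^-1 v \in Gp by rewrite pm_pla ?groupV ?xiG.
  move: (pla _ v) Hw => w Hw.
  have [Hl Hr e] := mp_act _ _ Hu (xiG _ Hw).
  have [Hpl Hpr e'] := pm_act _ _ (xiG _ Hu) Hw.
  rewrite /commute A_mul // (mc_braid u w) //.
  (* With this, [A_mul] applied to [pla (xi u) w] and [ra u (xi w)] computes the product in the
     opposite order; the claim is the square [u * xi w = la * ra], whose [la] is [xi (pla (xi u) w)]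
     by [la_xi]. *)
  suff [E _] : pla (xi (pla (xi u) w)) (ra u (xi w)) = u
     /\ pra (xi (pla (xi u) w)) (ra u (xi w)) = xi w.
    by have := A_mul _ _ Hpl Hr; rewrite E => <-.
  by apply: pm_actE; rewrite ?xiG // -la_xi.
rewrite /normal subsetT /=; apply/subsetP => g _.
have NM x : x \in Gm -> x \in 'N(A_xi Gp xi).
  move=> Hx; rewrite -groupV inE; apply/subsetP => _ /imsetP[_ /A_xiP[u Hu ->] ->].
  rewrite conjgE invgK mulgA A_conj // A_xi_mem //.
  by have [] := pm_act _ _ Hx Hu.
have [u [x [Hu Hx ->]]] := uf_pm g.
rewrite groupM ?(NM _ Hx) //.
(* An element of [Gp] is an element of [A_xi] times one of [Gm], and both normalize [A_xi]. *)
rewrite -[u](mulgKV (xi u)) groupM //; last exact: NM (xiG _ Hu).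
exact: (subsetP (normG (Group AG)) _ (A_xi_mem _ Hu)).
Qed.
End Matched.

(** An element of [A_xi] is determined by its [Gp] part. Comparing [Gm] parts of a conjugate of
    [u * (xi u)^-1] gives the second identity; comparing [Gp] parts of two commuting products gives
    the first. *)
Lemma abelian_normal_matched :
  abelian_normal_subgroup (A_xi Gp xi) -> matched_condition Gp Gm xi.
Proof.
case/and3P=> AG /centsP Ac /andP[_ /subsetP An].
have cj u x : u \in Gp -> x \in Gm -> xi (pla x u) * pra x u = x * xi u.
  move=> Hu Hx; have [Hl Hr e] := pm_act _ _ Hx Hu.
  have := An x^-1 (in_setT _); rewrite inE => /subsetP An'.
  have : x * (u * (xi u)^-1) * x^-1 \in A_xi Gp xi.
    by apply/An'/imsetP; exists (u * (xi u)^-1); rewrite ?A_xi_mem // conjgE invgK !mulgA.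
  move/A_xiP=> [w Hw]; rewrite mulgA e => E.
  have [|||Ew E2] := @uf_inj (pla x u) (pra x u * ((xi u)^-1 * x^-1)) w (xi w)^-1 Hl _ Hw.
  - by rewrite !groupM ?groupV ?xiG.
  - by rewrite groupV xiG.
  - by rewrite -E !mulgA.
  by apply: invg_inj; rewrite Ew invMg -E2; gsimp.
have cjA x u : x \in Gm -> u \in Gp ->
  x * (u * (xi u)^-1) * x^-1 = pla x u * (xi (pla x u))^-1.
  move=> Hx Hu; have [Hl Hr e] := pm_act _ _ Hx Hu.
  by rewrite mulgA e -!mulgA -invMg -cj //; gsimp.
move=> u v x Hu Hv Hx; split; last exact: cj.
have [Hl Hr e] := pm_act _ _ (xiG _ Hu) Hv.
set v1 := pla (xi u) v in Hl e *.
have Hx1 : (xi v1)^-1 \in Gm by rewrite groupV xiG.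
have [Hl1 Hr1 e1] := pm_act _ _ Hx1 Hu; set w := pla _ u in Hl1 e1.
(* Both orders of the product of the elements of [A_xi] over [u] and [v1] are put in the form
   [g * (xi g)^-1], and the values of [g] are compared. *)
have Ec : u * v = v1 * w.
  have := Ac _ (A_xi_mem _ Hu) _ (A_xi_mem _ Hl); rewrite /commute.
  have -> : u * (xi u)^-1 * (v1 * (xi v1)^-1) = (u * v) * (xi (u * v))^-1.
    by rewrite -cjA ?xiG // xiM //; gsimp.
  have -> : v1 * (xi v1)^-1 * (u * (xi u)^-1) = (v1 * w) * (xi (v1 * w))^-1.
    have -> : v1 * w * (xi (v1 * w))^-1 = v1 * (w * (xi w)^-1) * (xi v1)^-1.
      by rewrite xiM //; gsimp.
    by rewrite -(cjA _ _ Hx1 Hu); gsimp.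
  by move/uf_inj; case; rewrite ?groupV ?xiG ?groupM.
rewrite Ec; congr (_ * _).
have [] // := mp_actE u (xi v) (xi v1) w; rewrite ?xiG //.
(* The label is found from the second identity at [(xi v1)^-1] and [xi] applied to [Ec]; it exhibits
   [w] as [ra u (xi v)]. *)
have Em : pra (xi v1)^-1 u = (xi v)^-1.
  have := cj u _ Hu Hx1; rewrite -/w => Em.
  apply: (mulgI (xi w)); rewrite Em; apply: (mulgI (xi v1)).
  by rewrite mulKVg mulgA -xiM // -Ec xiM // mulgK.
rewrite Em in e1.
by apply: (mulgI (xi v1)^-1); rewrite mulKg mulgA e1 mulgKV.
Qed.

(** * From factorizations to triples, and the round trip *)

Section AbelianNormal.
Hypothesis AN : abelian_normal_subgroup (A_xi Gp xi).
Variable A : {group gT}.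
Hypothesis defA : (A : {set gT}) = A_xi Gp xi.

Lemma xi_action : exists to : groupAction Gm A,
  {in A & Gm, forall a x, to a x = (a ^ x)%g}.
Proof.
have /and3P[_ _ /andP[_ An]] := AN.
have nGA : {acts Gm, on group A | 'J}.
  split; last exact: subsetT.
  by rewrite astabsJ defA; apply: subset_trans An; apply: subsetT.
exists (actby_groupAction nGA) => a x Ha Hx.
by rewrite /= /actby Ha Hx.
Qed.

Lemma xi_cocycle : exists zeta : gT -> gT,
  [/\ {in Gp, forall u, zeta (u * xi u^-1) = xi u},
      {in A, forall a, zeta a \in Gm} &
      {in A &, forall a b,
         zeta a * zeta b = zeta (a * (zeta a * b * (zeta a)^-1))}].
Proof.
(* The [Gp] part of [u * (xi u)^-1] is [u], so this total function takes the prescribed values. *)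
pose zeta g := xi (gplus Gp Gm g).
have zetaE u : u \in Gp -> zeta (u * (xi u)^-1) = xi u.
  by move=> Hu; rewrite /zeta gplusE // groupV xiG.
exists zeta; split=> [u Hu | a | a b]; rewrite ?defA.
- by rewrite xiV // zetaE.
- by case/A_xiP=> u Hu ->; rewrite zetaE // xiG.
case/A_xiP=> u Hu -> /A_xiP[v Hv ->]; rewrite !zetaE //.
by rewrite -xiM // -zetaE ?groupM // xiM //; congr zeta; gsimp.
Qed.

Variables (to : groupAction Gm A) (zeta : gT -> gT).
Hypothesis toE : {in A & Gm, forall a x, to a x = (a ^ x)%g}.
Hypothesis zetaE : {in Gp, forall u, zeta (u * xi u^-1)%g = xi u}.

Lemma sd_iso : exists phi : sdprod_by to -> gT,
  [/\ {morph phi : w1 w2 / (w1 * w2)%g} /\ bijective phi,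
      {in A & Gm, forall a x, phi (sdpair1 to a * sdpair2 to x)%g = (a * x)%g},
      phi @: sdGp to zeta = Gp, phi @: sdGm to = Gm &
      {in sdGp to zeta, forall w, phi (sdP to w) = xi (phi w)}].
Proof.
(* The underlying pair [(x, a)] of [w] stands for the product in the order [x a], hence the order of
   the factors. *)
pose phi (w : sdprod_by to) := (val w).1 * (val w).2.
have valP (w : sdprod_by to) : (val w).1 \in Gm /\ (val w).2 \in A.
  by case: w => [[x a] /= /setXP].
have phiM : {morph phi : w1 w2 / w1 * w2}.
  move=> w1 w2; rewrite /phi /=.
  have [H11 H12] := valP w1; have [H21 H22] := valP w2.
  by rewrite toE //= conjgE; gsimp.
have phi1 a : a \in A -> phi (sdpair1 to a) = a.
  by move=> Ha; rewrite /phi val_insubd inE group1 Ha mul1g.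
have phi2 x : x \in Gm -> phi (sdpair2 to x) = x.
  by move=> Hx; rewrite /phi val_insubd inE group1 Hx mulg1.
have phi12 : {in A & Gm, forall a x, phi (sdpair1 to a * sdpair2 to x) = a * x}.
  by move=> a x Ha Hx; rewrite phiM phi1 ?phi2.
(* The inverse of [phi] rewrites [u x] as [(u xi(u)^-1)(xi(u) x)]. *)
pose psi g := sdpair1 to (gplus Gp Gm g * (xi (gplus Gp Gm g))^-1)
              * sdpair2 to (xi (gplus Gp Gm g) * gminus Gp Gm g).
have AE u : u \in Gp -> u * (xi u)^-1 \in A by rewrite defA; apply: A_xi_mem.
have zE u : u \in Gp -> zeta (u * (xi u)^-1) = xi u.
  by move=> Hu; rewrite -xiV // zetaE.
exists phi; split=> //.
- split=> //; exists psi => [w | g].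
    have [a [x [Ha Hx ->]]] := sdpair12_ex _ _ _ _ to w; rewrite phi12 // /psi.
    move: Ha; rewrite defA => /A_xiP[u Hu ->].
    rewrite -mulgA gplusE ?gminusE //; try by rewrite groupM ?groupV ?xiG.
    by rewrite mulKVg.
  have [u [x [Hu Hx ->]]] := uf_pm g; rewrite /psi gplusE ?gminusE //.
  by rewrite phi12 ?AE ?groupM ?xiG //; gsimp.
- apply/setP=> g; apply/imsetP/idP => [[_ /imsetP[a Ha ->] ->] | Hg].
    move: Ha; rewrite defA => /A_xiP[u Hu ->].
    by rewrite phi12 ?AE // zE ?xiG //; gsimp.
  exists (sdpair1 to (g * (xi g)^-1) * sdpair2 to (xi g)).
    by apply/imsetP; exists (g * (xi g)^-1); rewrite ?AE // zE.
  by rewrite phi12 ?AE ?xiG //; gsimp.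
- apply/setP=> g; apply/imsetP/idP => [[_ /imsetP[x Hx ->] ->] | Hg].
    by rewrite phi2.
  by exists (sdpair2 to g); rewrite ?phi2 //; apply/imsetP; exists g.
move=> _ /imsetP[a Ha ->].
move: (Ha); rewrite defA => /A_xiP[u Hu ea]; rewrite ea zE //.
by rewrite sdP_pair ?AE ?xiG // phi12 ?AE ?xiG // phi2 ?xiG //; gsimp.
Qed.
End AbelianNormal.
End Homomorphism.

(** * The Hopf algebra operations in the coordinates [u x] of [G] *)

Lemma pm_eqE u x v y : u \in Gp -> x \in Gm -> v \in Gp -> y \in Gm ->
  (u * x == v * y) = (u == v) && (x == y).
Proof.
move=> Hu Hx Hv Hy; apply/eqP/andP => [e | [/eqP-> /eqP->] //].
by have [-> ->] := uf_inj _ _ _ _ Hu Hx Hv Hy e.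
Qed.

Lemma pm_GpE u x : u \in Gp -> x \in Gm -> (u * x \in Gp) = (x == 1).
Proof.
move=> Hu Hx; rewrite groupMl //; apply/idP/eqP => [Hx'|->]; last exact: group1.
have [|_ //] := @uf_inj x 1 1 x Hx' (group1 _) (group1 _) Hx.
by rewrite mulg1 mul1g.
Qed.

Lemma deltaM b c : delta (b && c) = (delta b * delta c)%R.
Proof. by rewrite /delta -GRing.natrM mulnb. Qed.

Lemma sum_delta (T : finType) (F : T -> CC) t0 :
  (\sum_t F t * delta (t == t0) = F t0)%R.
Proof.
rewrite (bigD1 t0) //= big1 ?GRing.addr0 => [|t /negPf ne].
  by rewrite /delta eqxx GRing.mulr1.
by rewrite /delta ne GRing.mulr0.
Qed.

Lemma sum_delta_in (T : finType) (A : {set T}) (F : T -> CC) t0 : t0 \in A ->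
  (\sum_(t in A) F t * delta (t == t0) = F t0)%R.
Proof.
move=> Ht; rewrite (bigD1 t0) //= big1 ?GRing.addr0 => [|t /andP[_ /negPf ne]].
  by rewrite /delta eqxx GRing.mulr1.
by rewrite /delta ne GRing.mulr0.
Qed.

Lemma sum_pair (X Y : finType) (F : X * Y -> CC) :
  (\sum_p F p = \sum_x \sum_y F (x, y))%R.
Proof. by rewrite pair_bigA; apply: eq_bigr => -[]. Qed.

Lemma sum_pm (F : gT -> CC) :
  (\sum_g F g = \sum_(u in Gp) \sum_(x in Gm) F (u * x)%g)%R.
Proof.
rewrite pair_big /= (reindex_onto (fun p : gT * gT => p.1 * p.2)
  (fun g => (gplus Gp Gm g, gminus Gp Gm g))) /=.
  apply: eq_bigl => -[u x] /=; apply/eqP/andP => [[] | [Hu Hx]].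
    have [v [y [Hv Hy ->]]] := uf_pm (u * x).
    by rewrite gplusE ?gminusE // => <- <-.
  by rewrite gplusE ?gminusE.
by move=> g _; have [v [y [Hv Hy ->]]] := uf_pm g; rewrite gplusE ?gminusE.
Qed.

(** Composition in the groupoid solved for the second arrow: it starts at the target [ra u x] of the
    first and carries the remaining label [x^-1 * m]. *)
Lemma mulc_pm v x h u m : v \in Gp -> x \in Gm -> u \in Gp -> m \in Gm ->
  Defs.mulc Gp Gm (v * x) h (u * m) = delta ((v == u) && (h == ra u x * (x^-1 * m))).
Proof.
move=> Hv Hx Hu Hm; have [w [y [Hw Hy ->]]] := uf_pm h.
rewrite /Defs.mulc !gplusE ?gminusE // -mulgA.
rewrite !pm_eqE ?groupM ?groupV ?mp_ra //.
congr delta; have -> : (m == x * y) = (y == x^-1 * m).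
  by apply/eqP/eqP => ->; rewrite ?mulKVg ?mulKg.
case: (v =P u) => [->|ne]; first by rewrite eqxx andTb eq_sym.
by rewrite [u == v]eq_sym (introF eqP ne) andbF.
Qed.

Lemma sum_mulc (f : gT -> gT -> CC) u m : u \in Gp -> m \in Gm ->
  (\sum_g \sum_h f g h * Defs.mulc Gp Gm g h (u * m)%g
   = \sum_(x in Gm) f (u * x)%g (ra u x * (x^-1 * m))%g)%R.
Proof.
move=> Hu Hm; rewrite sum_pm (bigD1 u) //= [X in (_ + X)%R]big1 => [|v /andP[Hv ne]].
  rewrite GRing.addr0; apply: eq_bigr => x Hx; rewrite -[RHS]sum_delta.
  by apply: eq_bigr => h _; rewrite mulc_pm // eqxx.
rewrite big1 // => x Hx; rewrite big1 // => h _.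
by rewrite mulc_pm // (negPf ne) GRing.mulr0.
Qed.

(** Structure constants of a tensor product are products, so the sums can be evaluated one factor at
    a time. The evaluations [Lx] and [Ly] are abstract so that iterating the lemma also covers three
    factors. *)
Lemma sum_mul_prod (X Y : finType) (mx : X -> X -> CC) (my : Y -> Y -> CC)
    (Lx : (X -> X -> CC) -> CC) (Ly : (Y -> Y -> CC) -> CC) :
  (forall f, \sum_p \sum_q f p q * mx p q = Lx f)%R ->
  (forall f, \sum_p \sum_q f p q * my p q = Ly f)%R ->
  forall f : X * Y -> X * Y -> CC,
  (\sum_p \sum_q f p q * (mx p.1 q.1 * my p.2 q.2)
   = Lx (fun p1 q1 => Ly (fun p2 q2 => f (p1, p2) (q1, q2))))%R.
Proof.
move=> HX HY f; rewrite -HX sum_pair; apply: eq_bigr => p1 _.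
under eq_bigr => p2 _ do rewrite sum_pair.
rewrite exchange_big /=; apply: eq_bigr => q1 _.
rewrite -HY GRing.mulr_suml; apply: eq_bigr => p2 _.
rewrite GRing.mulr_suml; apply: eq_bigr => q2 _.
by rewrite -GRing.mulrA [(my _ _ * _)%R]GRing.mulrC.
Qed.

Lemma t2mulE A B u m v n : u \in Gp -> m \in Gm -> v \in Gp -> n \in Gm ->
  (t2mul Gp Gm A B (u * m, v * n)%g
   = \sum_(x in Gm) \sum_(y in Gm)
       A (u * x, v * y)%g * B (ra u x * (x^-1 * m), ra v y * (y^-1 * n))%g)%R.
Proof.
move=> Hu Hm Hv Hn; rewrite ffunE /=.
under eq_bigr => p _ do under eq_bigr => q _ do rewrite -GRing.mulrA.
exact: (sum_mul_prod _ _ _ _ _ _ (fun f => sum_mulc f _ _ Hu Hm)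
  (fun f => sum_mulc f _ _ Hv Hn) (fun p q => A p * B q)%R).
Qed.

Lemma t3mulE A B u m v n w l : u \in Gp -> m \in Gm -> v \in Gp -> n \in Gm ->
  w \in Gp -> l \in Gm ->
  (t3mul Gp Gm A B (u * m, v * n, w * l)%g
   = \sum_(x in Gm) \sum_(y in Gm) \sum_(z in Gm)
       A (u * x, v * y, w * z)%g *
       B (ra u x * (x^-1 * m), ra v y * (y^-1 * n), ra w z * (z^-1 * l))%g)%R.
Proof.
move=> Hu Hm Hv Hn Hw Hl; rewrite ffunE /=.
under eq_bigr => p _ do under eq_bigr => q _ do
  rewrite -GRing.mulrA -GRing.mulrA [(Defs.mulc _ _ _ _ _ * (_ * _))%R]GRing.mulrA.
exact: (sum_mul_prod _ _ _ _ _ _ (sum_mul_prod _ _ _ _ _ _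
    (fun f => sum_mulc f _ _ Hu Hm) (fun f => sum_mulc f _ _ Hv Hn))
  (fun f => sum_mulc f _ _ Hw Hl) (fun p q => A p * B q)%R).
Qed.

(** Only the summand [h = v] can have second leg [v * n]; the [Gp] part of the first leg then
    recovers that of [g]. *)
Lemma coprodcE g u m v n : u \in Gp -> m \in Gm -> v \in Gp -> n \in Gm ->
  coprodc Gp Gm g (u * m) (v * n) = delta ((g == u * v * n) && (m == la v n)).
Proof.
move=> Hu Hm Hv Hn; have [w [l [Hw Hl ->]]] := uf_pm g.
rewrite /coprodc gplusE ?gminusE // (bigD1 v) //= big1 => [|h /andP[Hh ne]].
  rewrite GRing.addr0 !pm_eqE ?groupM ?groupV ?mp_la // eqxx /=.
  rewrite [l == n]eq_sym; have [->|] := eqVneq n l; last by rewrite !andbF.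
  congr delta; rewrite !andbT; congr (_ && _).
  by apply/eqP/eqP => ->; rewrite ?mulgKV ?mulgK.
by rewrite [v * n == _]pm_eqE // [v == h]eq_sym (negPf ne) andbF.
Qed.

Lemma hcoprodE f u m v n : u \in Gp -> m \in Gm -> v \in Gp -> n \in Gm ->
  (hcoprod Gp Gm f (u * m, v * n)%g = f (u * v * n)%g * delta (m == la v n))%R.
Proof.
move=> Hu Hm Hv Hn; rewrite ffunE /= -[RHS]/((fun g => f g * _) _)%R -sum_delta.
by apply: eq_bigr => g _; rewrite coprodcE // andbC deltaM GRing.mulrA.
Qed.

Lemma coprod_idE R u m v n k : u \in Gp -> m \in Gm -> v \in Gp -> n \in Gm ->
  (coprod_id Gp Gm R (u * m, v * n, k)%g
   = R (u * v * n, k)%g * delta (m == la v n))%R.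
Proof.
move=> Hu Hm Hv Hn; rewrite ffunE /= -[RHS]/((fun p => R p * _) _)%R -sum_delta.
apply: eq_bigr => -[g h] _; rewrite coprodcE //= xpair_eqE [k == h]eq_sym.
by rewrite andbC !deltaM !GRing.mulrA.
Qed.

Lemma id_coprodE R k v n w l : v \in Gp -> n \in Gm -> w \in Gp -> l \in Gm ->
  (id_coprod Gp Gm R (k, v * n, w * l)%g
   = R (k, v * w * l)%g * delta (n == la w l))%R.
Proof.
move=> Hv Hn Hw Hl; rewrite ffunE /= -[RHS]/((fun p => R p * _) _)%R -sum_delta.
apply: eq_bigr => -[g h] _; rewrite coprodcE //= xpair_eqE [k == g]eq_sym.
rewrite !deltaM -!GRing.mulrA; congr (_ * _)%R.
by rewrite GRing.mulrA GRing.mulrC.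
Qed.

Lemma ffun2_pm (f g : {ffun gT * gT -> CC}) :
  (forall u m v n, u \in Gp -> m \in Gm -> v \in Gp -> n \in Gm ->
    f (u * m, v * n) = g (u * m, v * n)) -> f = g.
Proof.
move=> H; apply/ffunP => -[k1 k2].
have [u [m [Hu Hm ->]]] := uf_pm k1; have [v [n [Hv Hn ->]]] := uf_pm k2.
exact: H.
Qed.

Lemma ffun3_pm (f g : {ffun gT * gT * gT -> CC}) :
  (forall u m v n w l, u \in Gp -> m \in Gm -> v \in Gp -> n \in Gm ->
    w \in Gp -> l \in Gm ->
    f (u * m, v * n, w * l) = g (u * m, v * n, w * l)) -> f = g.
Proof.
move=> H; apply/ffunP => -[[k1 k2] k3].
have [u [m [Hu Hm ->]]] := uf_pm k1; have [v [n [Hv Hn ->]]] := uf_pm k2.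
have [w [l [Hw Hl ->]]] := uf_pm k3; exact: H.
Qed.

Lemma t2oneE u m v n : u \in Gp -> m \in Gm -> v \in Gp -> n \in Gm ->
  (t2one Gp (u * m, v * n)%g = delta ((m == 1%g) && (n == 1%g)))%R.
Proof. by move=> Hu Hm Hv Hn; rewrite ffunE /= !pm_GpE. Qed.

Lemma t2mulA A B C :
  t2mul Gp Gm (t2mul Gp Gm A B) C = t2mul Gp Gm A (t2mul Gp Gm B C).
Proof.
apply: ffun2_pm => u m v n Hu Hm Hv Hn; rewrite !t2mulE //.
transitivity (\sum_(x in Gm) \sum_(y in Gm) \sum_(x' in Gm) \sum_(y' in Gm)
  A (u * x', v * y')%g * B (ra u x' * (x'^-1 * x), ra v y' * (y'^-1 * y))%g
  * C (ra u x * (x^-1 * m), ra v y * (y^-1 * n))%g)%R.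
  apply: eq_bigr => x Hx; apply: eq_bigr => y Hy; rewrite t2mulE //.
  rewrite GRing.mulr_suml; apply: eq_bigr => x' Hx'.
  by rewrite GRing.mulr_suml.
pose T x y x' y' := (A (u * x', v * y')%g * B (ra u x' * (x'^-1 * x),
  ra v y' * (y'^-1 * y))%g * C (ra u x * (x^-1 * m), ra v y * (y^-1 * n))%g)%R.
transitivity (\sum_(x' in Gm) \sum_(y' in Gm) \sum_(x in Gm) \sum_(y in Gm)
  T x y x' y')%R.
  under eq_bigr => x _ do rewrite exchange_big.
  rewrite exchange_big; apply: eq_bigr => x' _ /=.
  under eq_bigr => x _ do rewrite exchange_big.
  by rewrite exchange_big.
apply: eq_bigr => x Hx; apply: eq_bigr => y Hy.
rewrite t2mulE ?mp_ra ?groupM ?groupV // GRing.mulr_sumr.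
(* Translation replaces the label of a composite of two arrows by the label of its second arrow. *)
have rei z : z \in Gm -> forall F : gT -> CC,
    (\sum_(t in Gm) F t = \sum_(t in Gm) F (z * t)%g)%R.
  move=> Hz F; rewrite (reindex_inj (mulgI z)); apply: eq_bigl => t.
  by rewrite groupMl.
rewrite (rei x) //; apply: eq_bigr => x' Hx'.
rewrite GRing.mulr_sumr (rei y) //; apply: eq_bigr => y' Hy'.
rewrite /T -GRing.mulrA !mulKg.
have [_ ->] := mp_Mr _ _ _ Hu Hx Hx'; have [_ ->] := mp_Mr _ _ _ Hv Hy Hy'.
by rewrite !invMg !mulgA.
Qed.

Lemma t2mul1 A : t2mul Gp Gm A (t2one Gp) = A.
Proof.
apply: ffun2_pm => u m v n Hu Hm Hv Hn; rewrite t2mulE //.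
have eqV (x y : gT) : (x^-1 * y == 1) = (x == y).
  by rewrite -eq_mulVg1.
rewrite -[RHS](sum_delta_in _ Gm (fun x => A (u * x, v * n)%g) m) //.
apply: eq_bigr => x Hx.
rewrite -[A (u * x, v * n)](sum_delta_in _ Gm (fun y => A (u * x, v * y)%g) n) //.
rewrite GRing.mulr_suml; apply: eq_bigr => y Hy.
by rewrite t2oneE ?mp_ra ?groupM ?groupV // !eqV andbC deltaM GRing.mulrA.
Qed.

Lemma flip2K A : flip2 (flip2 A) = A :> {ffun gT * gT -> CC}.
Proof. by apply/ffunP => -[k1 k2]; rewrite !ffunE. Qed.

Lemma flip2M A B :
  flip2 (t2mul Gp Gm A B) = t2mul Gp Gm (flip2 A) (flip2 B).
Proof.
apply: ffun2_pm => u m v n Hu Hm Hv Hn; rewrite ffunE /= !t2mulE //.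
rewrite exchange_big; apply: eq_bigr => x _; apply: eq_bigr => y _.
by rewrite !ffunE.
Qed.

Lemma flip2_1 : flip2 (t2one Gp) = t2one Gp.
Proof. by apply/ffunP => -[k1 k2]; rewrite !ffunE /= andbC. Qed.

(** Conjugation by [R] becomes an intertwining relation free of the inverse, which is easier to
    compare coefficientwise. *)
Lemma cocommE R Ri : t2mul Gp Gm R Ri = t2one Gp -> t2mul Gp Gm Ri R = t2one Gp ->
  forall D D', D' = t2mul Gp Gm (t2mul Gp Gm R D) Ri <->
    t2mul Gp Gm D' R = t2mul Gp Gm R D.
Proof.
move=> H1 H2 D D'; split=> [-> | e]; first by rewrite t2mulA H2 t2mul1.
by rewrite -e t2mulA H1 t2mul1.
Qed.

(** * Products with an [R] that has one arrow out of each object *)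

Section Monomial.
Variables (R : {ffun gT * gT -> CC}) (c : gT -> gT -> CC) (a b : gT -> gT -> gT).
Hypothesis aG : forall u v, u \in Gp -> v \in Gp -> a u v \in Gm.
Hypothesis bG : forall u v, u \in Gp -> v \in Gp -> b u v \in Gm.
Hypothesis RE : forall u x v y, u \in Gp -> x \in Gm -> v \in Gp -> y \in Gm ->
  R (u * x, v * y) = (c u v * delta ((x == a u v) && (y == b u v)))%R.

Lemma t2mul_monomial B u m v n : u \in Gp -> m \in Gm -> v \in Gp -> n \in Gm ->
  t2mul Gp Gm R B (u * m, v * n)
  = (c u v * B (ra u (a u v) * ((a u v)^-1 * m),
                ra v (b u v) * ((b u v)^-1 * n))%g)%R.
Proof.
move=> Hu Hm Hv Hn; rewrite t2mulE //.
rewrite -[RHS](sum_delta_in _ Gm (fun x => c u v * B (ra u x * (x^-1 * m),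
  ra v (b u v) * ((b u v)^-1 * n))%g)%R) ?aG //.
apply: eq_bigr => x Hx.
rewrite -[RHS](sum_delta_in _ Gm (fun y => c u v * B (ra u x * (x^-1 * m),
  ra v y * (y^-1 * n))%g * delta (x == a u v))%R (b u v)) ?bG //.
by apply: eq_bigr => y Hy; rewrite RE // deltaM -!GRing.mulrA; congr (_ * _)%R;
  rewrite [RHS]GRing.mulrC !GRing.mulrA.
Qed.

(** All three label sums collapse: at [a u w] and [b u w] in the legs where [R13] carries [R], and
    at 1 in its middle leg. The unit in the first leg of [R23] then forces [m = a u w]. *)
Lemma R13_R23E u m v n w l : u \in Gp -> m \in Gm -> v \in Gp -> n \in Gm ->
  w \in Gp -> l \in Gm ->
  t3mul Gp Gm (R13 Gp R) (R23 Gp R) (u * m, v * n, w * l)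
  = (c u w * (delta (m == a u w) *
      R (v * n, ra w (b u w) * ((b u w)^-1 * l))%g))%R.
Proof.
move=> Hu Hm Hv Hn Hw Hl; rewrite t3mulE //.
have [_ rav1] := mp_1r _ Hv.
rewrite -[RHS](sum_delta_in _ Gm (fun x => c u w * (delta (m == x) *
      R (v * n, ra w (b u w) * ((b u w)^-1 * l))%g))%R) ?aG //.
apply: eq_bigr => x Hx.
pose F y := (c u w * (delta (m == x) *
      R (ra v y * (y^-1 * n), ra w (b u w) * ((b u w)^-1 * l))%g) *
      delta (x == a u w))%R.
have -> : (c u w * (delta (m == x) *
      R (v * n, ra w (b u w) * ((b u w)^-1 * l))%g) * delta (x == a u w))%R = F 1.
  by rewrite /F rav1 invg1 mul1g.
rewrite -(sum_delta_in _ Gm F); last exact: group1.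
apply: eq_bigr => y Hy; rewrite /F.
rewrite -[RHS](sum_delta_in _ Gm (fun z => c u w * (delta (m == x) *
    R (ra v y * (y^-1 * n), ra w z * (z^-1 * l))%g) *
    delta (x == a u w) * delta (y == 1%g))%R (b u w)) ?bG //.
apply: eq_bigr => z Hz; rewrite !ffunE /= RE // !pm_GpE ?mp_ra ?groupM ?groupV //.
by rewrite -eq_mulVg1 [x == m]eq_sym deltaM; ring.
Qed.

(** The same collapse; here the unit of [R12] sits in the third leg and forces [l = b u w]. *)
Lemma R13_R12E u m v n w l : u \in Gp -> m \in Gm -> v \in Gp -> n \in Gm ->
  w \in Gp -> l \in Gm ->
  t3mul Gp Gm (R13 Gp R) (R12 Gp R) (u * m, v * n, w * l)
  = (c u w * (delta (l == b u w) *
      R (ra u (a u w) * ((a u w)^-1 * m), v * n)%g))%R.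
Proof.
move=> Hu Hm Hv Hn Hw Hl; rewrite t3mulE //.
have [_ rav1] := mp_1r _ Hv.
rewrite -[RHS](sum_delta_in _ Gm (fun x => c u w * (delta (l == b u w) *
      R (ra u x * (x^-1 * m), v * n)%g))%R) ?aG //.
apply: eq_bigr => x Hx.
pose F y := (c u w * (delta (l == b u w) *
      R (ra u x * (x^-1 * m), ra v y * (y^-1 * n))%g) *
      delta (x == a u w))%R.
have -> : (c u w * (delta (l == b u w) *
      R (ra u x * (x^-1 * m), v * n)%g) * delta (x == a u w))%R = F 1.
  by rewrite /F rav1 invg1 mul1g.
rewrite -(sum_delta_in _ Gm F); last exact: group1.
apply: eq_bigr => y Hy; rewrite /F.
rewrite -[RHS](sum_delta_in _ Gm (fun z => c u w * (delta (l == z) *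
    R (ra u x * (x^-1 * m), ra v y * (y^-1 * n))%g) *
    delta (x == a u w) * delta (y == 1%g))%R (b u w)) ?bG //.
apply: eq_bigr => z Hz; rewrite !ffunE /= RE // !pm_GpE ?mp_ra ?groupM ?groupV //.
by rewrite -eq_mulVg1 [z == l]eq_sym deltaM; ring.
Qed.
End Monomial.

(** * Item (i), sufficiency: the axioms for [R_of_xi] *)

Section Sufficiency.
Variable xi : gT -> gT.
Hypothesis hxi : grp_hom_on Gp Gm xi.
Hypothesis mc : matched_condition Gp Gm xi.

(** The labels [a] and [b] of the arrow of [R_of_xi] out of the object [(u, v)]; [b] takes a second
    argument to fit the monomial lemmas. *)
Let a u v := (pra (xi v) u)^-1.
Let b u (_ : gT) := xi u.
Let xi_mem u (Hu : u \in Gp) : xi u \in Gm := hxi.2 u Hu.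

Lemma xi_a_mem u v : u \in Gp -> v \in Gp -> a u v \in Gm.
Proof. by move=> Hu Hv; rewrite /a groupV pm_pra ?xi_mem. Qed.

Lemma xi_b_mem u v : u \in Gp -> v \in Gp -> b u v \in Gm.
Proof. by move=> Hu _; apply: xi_mem. Qed.

Lemma mul_xi_a u v : u \in Gp -> v \in Gp -> u * a u v = (xi v)^-1 * pla (xi v) u.
Proof.
move=> Hu Hv; apply: (mulgI (xi v)); rewrite mulKVg mulgA (pm_swap (xi v) u) ?xi_mem //.
by rewrite /a mulgK.
Qed.

Lemma xi_a_act u v : u \in Gp -> v \in Gp ->
  la u (a u v) = (xi v)^-1 /\ ra u (a u v) = pla (xi v) u.
Proof.
move=> Hu Hv; apply: mp_actE; rewrite ?groupV ?xi_mem ?pm_pla ?xi_mem //.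
exact: mul_xi_a.
Qed.

Lemma R_of_xiE u x v y : u \in Gp -> x \in Gm -> v \in Gp -> y \in Gm ->
  R_of_xi Gp Gm xi (u * x, v * y) = (1 * delta ((x == a u v) && (y == b u v)))%R.
Proof.
move=> Hu Hx Hv Hy; rewrite ffunE GRing.mul1r.
rewrite -[RHS](sum_delta_in _ Gp (fun u' =>
  delta ((x == a u' v) && (y == b u' v)))) //.
apply: eq_bigr => u' Hu'.
rewrite -[RHS](sum_delta_in _ Gp (fun v' =>
  delta ((x == a u' v') && (y == b u' v')) * delta (u' == u))%R) //.
apply: eq_bigr => v' Hv'.
rewrite xpair_eqE !pm_eqE ?groupV ?pm_pra ?xi_mem //.
by rewrite !deltaM [u == u']eq_sym [v == v']eq_sym; ring.
Qed.

Lemma R_of_xi_positive : positive (R_of_xi Gp Gm xi).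
Proof.
move=> p; rewrite ffunE; apply: Num.Theory.sumr_ge0 => u _.
by apply: Num.Theory.sumr_ge0 => v _; apply: Num.Theory.ler0n.
Qed.

Let t2mul_R := t2mul_monomial _ _ _ _ xi_a_mem xi_b_mem R_of_xiE.

Lemma pm_xi_ra u v : u \in Gp -> v \in Gp ->
  pra (xi (pla (xi v) u)) (ra v (xi u)) = xi u
  /\ v * u = pla (xi v) u * ra v (xi u).
Proof.
move=> Hu Hv; split; last exact: mc_braid.
have [] // := pm_actE (ra v (xi u)) (xi (pla (xi v) u)) (xi u) v; first exact: xi_mem.
by rewrite -(la_xi xi) // -mp_swap ?xi_mem.
Qed.

(** The arrow out of [(u, v)] ends at [(pla (xi v) u, ra v (xi u))]. By [pm_xi_ra] and [xi_ra] the
    flipped arrow starting there has the inverse labels, so the composite is an identity. *)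
Lemma R_of_xi_inverse :
  t2mul Gp Gm (R_of_xi Gp Gm xi) (flip2 (R_of_xi Gp Gm xi)) = t2one Gp.
Proof.
apply: ffun2_pm => u m v n Hu Hm Hv Hn; rewrite t2mul_R // ffunE /= t2oneE //.
have [la_a ra_a] := xi_a_act _ _ Hu Hv.
rewrite R_of_xiE ?(mp_ra, xi_a_mem, xi_b_mem, groupM, groupV) // !GRing.mul1r ra_a {1}/a /b.
have [-> _] := pm_xi_ra _ _ Hu Hv.
rewrite (xi_ra xi) // {1}/a invgK andbC.
have E (g x : gT) : (g * x == g) = (x == 1).
  by rewrite -{2}[g]mulg1 (inj_eq (mulgI g)).
by rewrite !E.
Qed.

(** Each side reduces to a single term: an arrow of [R] followed by one of the coproduct, or one of
    the flipped coproduct followed by an arrow of [R]. The two paths form a commuting square. *)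
Lemma R_of_xi_cocommutative f :
  t2mul Gp Gm (flip2 (hcoprod Gp Gm f)) (R_of_xi Gp Gm xi)
  = t2mul Gp Gm (R_of_xi Gp Gm xi) (hcoprod Gp Gm f).
Proof.
apply: ffun2_pm => u m v n Hu Hm Hv Hn; rewrite t2mul_R // GRing.mul1r.
have [_ ra_a] := xi_a_act _ _ Hu Hv.
have [_ Ebr] := pm_xi_ra _ _ Hu Hv.
have Hvb : ra v (xi u) \in Gp by rewrite mp_ra ?xi_mem.
have Hua : pla (xi v) u \in Gp by rewrite pm_pla ?xi_mem.
rewrite hcoprodE ?(mp_ra, xi_a_mem, xi_b_mem, groupM, groupV) // ra_a /b -Ebr t2mulE //.
(* The label left for the coproduct in the second leg once [R] has used [xi u]. *)
pose x0 := (xi u)^-1 * n; have Hx0 : x0 \in Gm by rewrite groupM ?groupV ?xi_mem.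
(* Both paths of the square have the same label in the first leg: multiplied by [u], each becomes
   the same element [(xi v)^-1 * la v (la u x)] times an element of [Gp]. *)
have Eda x : x \in Gm -> x * a (ra u x) (ra v (la u x)) = a u v * la (ra v (xi u)) x.
  move=> Hx; have Hy := mp_la _ _ Hu Hx; have Hux := mp_ra _ _ Hu Hx.
  have Hz := mp_la _ _ Hv Hy; have Hvy := mp_ra _ _ Hv Hy.
  apply: (uf_mp_eqm u _ _ (pla (xi (ra v (la u x))) (ra u x))
    (ra (pla (xi v) u) (la (ra v (xi u)) x)) _ _ _ _ _
    ((xi v)^-1 * la v (la u x))) => //.
  - by rewrite groupM ?xi_a_mem.
  - by rewrite groupM ?xi_a_mem ?mp_la.
  - by rewrite pm_pla ?xi_mem.
  - by rewrite !mp_ra ?mp_la.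
  - have e := mc_conj xi mc _ _ _ _ Hz Hvy Hy Hv (esym (mp_swap _ _ Hv Hy)).
    rewrite mulgA (mp_swap u x) // -mulgA mul_xi_a // !mulgA; congr (_ * _).
    by apply: (mulgI (xi v)); rewrite mulKVg mulgA e mulgK.
  rewrite mulgA mul_xi_a // -!mulgA; congr (_ * _).
  rewrite (mp_swap (pla (xi v) u)) ?mp_la //; congr (_ * _).
  have [<- _] := mp_Ml _ _ _ Hua Hvb Hx; rewrite -Ebr.
  by have [-> _] := mp_Ml _ _ _ Hv Hu Hx.
have HE : ((a u v)^-1 * m == la (ra v (xi u)) x0)
        = (x0^-1 * m == a (ra u x0) (ra v (la u x0))).
  have Vl (g h k : gT) : (g^-1 * h == k) = (h == g * k).
    by apply/eqP/eqP => [<-|->]; rewrite ?mulKVg ?mulKg.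
  by rewrite !Vl Eda.
rewrite HE -(sum_delta_in _ Gm (fun x => f (v * u * x)%g *
   delta (x^-1 * m == a (ra u x) (ra v (la u x)))%g)%R) //.
apply: eq_bigr => x Hx.
have Hy := mp_la _ _ Hu Hx; have Hux := mp_ra _ _ Hu Hx.
rewrite -[RHS](sum_delta_in _ Gm (fun y => f (v * u * x)%g *
  delta (x^-1 * m == a (ra u x) (ra v y))%g * delta (x == x0))%R _ Hy).
apply: eq_bigr => y Hy'; rewrite ffunE /= hcoprodE //.
rewrite R_of_xiE ?(mp_ra, xi_a_mem, xi_b_mem, groupM, groupV) //.
have [->|] := eqVneq y (la u x); last first.
  by move=> _; rewrite /delta /=; ring.
suff -> : ((la u x)^-1 * n == b (ra u x) (ra v (la u x))) = (x == x0).
  by rewrite deltaM; ring.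
have e := mc_conj xi mc _ _ _ _ Hy Hux Hx Hu (esym (mp_swap _ _ Hu Hx)).
rewrite /b /x0; apply/eqP/eqP => E; first by apply: (mulgI (xi u)); rewrite e -E !mulKVg.
by apply: (mulgI (la u x)); rewrite mulKVg -e E mulKVg.
Qed.

Lemma R_of_xi_coprod_id :
  coprod_id Gp Gm (R_of_xi Gp Gm xi)
  = t3mul Gp Gm (R13 Gp (R_of_xi Gp Gm xi)) (R23 Gp (R_of_xi Gp Gm xi)).
Proof.
apply: ffun3_pm => u m v n w l Hu Hm Hv Hn Hw Hl.
rewrite (R13_R23E _ _ _ _ xi_a_mem xi_b_mem R_of_xiE) // coprod_idE //.
rewrite !R_of_xiE ?(mp_ra, xi_a_mem, xi_b_mem, groupM, groupV) // !GRing.mul1r.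
have Hwu : ra w (xi u) \in Gp by rewrite mp_ra ?xi_mem.
(* Acting by [u * v] is acting by [u], then by [v]; [xi_ra] recognizes the intermediate label as a
   value of [xi]. *)
have E1 : a (u * v) w = a v (ra w (b u w)).
  by rewrite /a /b pra_M ?xi_mem // (xi_ra xi).
have E2 : la v (a v (ra w (b u w))) = a u w.
  by have [-> _] := xi_a_act v (ra w (xi u)) Hv Hwu; rewrite (xi_ra xi).
rewrite E1; have -> : b (u * v) w = xi u * xi v by apply: (xiM xi).
have -> : ((b u w)^-1 * l == b v (ra w (b u w))) = (l == xi u * xi v).
  by rewrite /b; apply/eqP/eqP => [<-|->]; rewrite ?mulKVg ?mulKg.
have [->|_] := eqVneq n (a v (ra w (b u w))); last by rewrite /delta /=; ring.
by rewrite E2 /=; ring.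
Qed.

Lemma R_of_xi_id_coprod :
  id_coprod Gp Gm (R_of_xi Gp Gm xi)
  = t3mul Gp Gm (R13 Gp (R_of_xi Gp Gm xi)) (R12 Gp (R_of_xi Gp Gm xi)).
Proof.
apply: ffun3_pm => u m v n w l Hu Hm Hv Hn Hw Hl.
rewrite (R13_R12E _ _ _ _ xi_a_mem xi_b_mem R_of_xiE) // id_coprodE //.
have [_ ra_a] := xi_a_act _ _ Hu Hw.
rewrite !R_of_xiE ?(mp_ra, xi_a_mem, xi_b_mem, groupM, groupV) // !GRing.mul1r ra_a /b.
have -> : a u (v * w) = a u w * a (pla (xi w) u) v.
  by rewrite /a (xiM xi) // pra_Ml ?xi_mem // invMg.
have -> : ((a u w)^-1 * m == a (pla (xi w) u) v) = (m == a u w * a (pla (xi w) u) v).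
  by apply/eqP/eqP => [<-|->]; rewrite ?mulKVg ?mulKg.
rewrite -(la_xi xi) // !deltaM.
by have [->|ne] := eqVneq l (xi u); [ring | rewrite /delta /=; ring].
Qed.

Lemma R_of_xi_counit_id : counit_id Gp Gm (R_of_xi Gp Gm xi) = hone Gp.
Proof.
apply/ffunP => h; have [w [l [Hw Hl ->]]] := uf_pm h.
rewrite !ffunE sum_pair pm_GpE //.
transitivity (\sum_g R_of_xi Gp Gm xi (g, w * l)%g * counitc Gp Gm g)%R.
  apply: eq_bigr => g _; rewrite /= -(sum_delta _ (fun k =>
    R_of_xi Gp Gm xi (g, k) * counitc Gp Gm g)%R).
  by apply: eq_bigr => k _; rewrite [k == _]eq_sym.
rewrite sum_pm; have H1 : 1 \in Gp := group1 _.
rewrite -[RHS](sum_delta_in _ Gp (fun=> delta (l == 1%g)) 1) //.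
apply: eq_bigr => u Hu.
rewrite -[RHS](sum_delta_in _ Gm (fun=> delta (l == 1%g) * delta (u == 1%g))%R (a u w))
  ?xi_a_mem //.
apply: eq_bigr => x Hx; rewrite R_of_xiE // /counitc gplusE //.
have [->|] := eqVneq u 1; last by move=> _; rewrite /delta /=; ring.
by rewrite /b (xi1 xi) // deltaM; ring.
Qed.

Lemma R_of_xi_id_counit : id_counit Gp Gm (R_of_xi Gp Gm xi) = hone Gp.
Proof.
apply/ffunP => g; have [u [m [Hu Hm ->]]] := uf_pm g.
rewrite !ffunE sum_pair exchange_big /= pm_GpE //.
transitivity (\sum_h R_of_xi Gp Gm xi (u * m, h)%g * counitc Gp Gm h)%R.
  apply: eq_bigr => h _; rewrite /= -(sum_delta _ (fun k =>
    R_of_xi Gp Gm xi (k, h) * counitc Gp Gm h)%R).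
  by apply: eq_bigr => k _; rewrite [k == _]eq_sym; ring.
rewrite sum_pm; have H1 : 1 \in Gp := group1 _.
rewrite -[RHS](sum_delta_in _ Gp (fun=> delta (m == 1%g)) 1) //.
apply: eq_bigr => v Hv.
rewrite -[RHS](sum_delta_in _ Gm (fun=> delta (m == 1%g) * delta (v == 1%g))%R (b u v))
  ?xi_b_mem //.
apply: eq_bigr => x Hx; rewrite R_of_xiE // /counitc gplusE //.
have [->|] := eqVneq v 1; last by move=> _; rewrite /delta /=; ring.
have -> : a u 1 = 1.
  rewrite /a (xi1 xi) //; have [] := pm_actE u 1 1 u; rewrite ?group1 //.
    by rewrite mul1g mulg1.
  by move=> _ ->; rewrite invg1.
by rewrite deltaM; ring.
Qed.

Lemma R_of_xi_triangular : triangular Gp Gm (R_of_xi Gp Gm xi).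
Proof.
have RF := R_of_xi_inverse.
have FR : t2mul Gp Gm (flip2 (R_of_xi Gp Gm xi)) (R_of_xi Gp Gm xi) = t2one Gp.
  by rewrite -{2}[R_of_xi _ _ _]flip2K -flip2M RF flip2_1.
split=> //; split; last exact: R_of_xi_id_counit.
- exists (flip2 (R_of_xi Gp Gm xi)); split=> // f.
  by apply/cocommE => //; apply: R_of_xi_cocommutative.
- exact: R_of_xi_coprod_id.
- exact: R_of_xi_id_coprod.
exact: R_of_xi_counit_id.
Qed.
End Sufficiency.

(** * Item (i): positivity makes [R] monomial *)

Lemma delta_neq0 b : (delta b != 0)%R = b.
Proof. by rewrite /delta; case: b; rewrite /= ?GRing.oner_neq0 ?eqxx. Qed.

Lemma delta1 : delta true = 1%R. Proof. by []. Qed.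

Lemma sum_neq0_ex (F : gT -> gT -> CC) :
  (\sum_(x in Gm) \sum_(y in Gm) F x y != 0)%R ->
  exists x y, [/\ x \in Gm, y \in Gm & (F x y != 0)%R].
Proof.
case: (pickP [pred p : gT * gT | [&& p.1 \in Gm, p.2 \in Gm & (F p.1 p.2 != 0)%R]]).
  by move=> [x y] /= /and3P[Hx Hy H] _; exists x, y.
move=> H N; case/eqP: N; apply: big1 => x Hx; apply: big1 => y Hy; apply/eqP.
by have := H (x, y); rewrite /= Hx Hy => /negbFE.
Qed.

Lemma sum_eq0_term (F : gT -> gT -> CC) x y :
  (forall x y, 0 <= F x y)%R ->
  (\sum_(x in Gm) \sum_(y in Gm) F x y = 0)%R ->
  x \in Gm -> y \in Gm -> F x y = 0%R.
Proof.
move=> F0 /Num.Theory.psumr_eq0P S Hx Hy.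
apply: (Num.Theory.psumr_eq0P _ (S _ x Hx)) => // x' _.
by apply: Num.Theory.sumr_ge0 => y' _.
Qed.

(* No cancellation can occur, so every composite of an arrow of R with an arrow
   of its inverse is an identity. *)
Lemma positive_invertible_monomial (R R' : {ffun gT * gT -> CC}) :
  positive R -> positive R' ->
  t2mul Gp Gm R R' = t2one Gp -> t2mul Gp Gm R' R = t2one Gp ->
  exists (a b : gT -> gT -> gT) (c : gT -> gT -> CC),
  [/\ forall u v, u \in Gp -> v \in Gp -> a u v \in Gm,
      forall u v, u \in Gp -> v \in Gp -> b u v \in Gm,
      forall u v, (0 <= c u v)%R,
      forall u v, u \in Gp -> v \in Gp -> (c u v != 0)%R &
      forall u x v y, u \in Gp -> x \in Gm -> v \in Gp -> y \in Gm ->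
        R (u * x, v * y)%g = (c u v * delta ((x == a u v) && (y == b u v)))%R].
Proof.
move=> R0 R'0 RR' R'R.
pose P u v (p : gT * gT) := [&& p.1 \in Gm, p.2 \in Gm & (R (u * p.1, v * p.2)%g != 0)%R].
pose ab u v := odflt (1, 1) [pick p | P u v p].
have rV (u x : gT) : u \in Gp -> x \in Gm -> ra (ra u x) x^-1 = u.
  move=> Hu Hx; have Hx' : x^-1 \in Gm by rewrite groupV.
  have [_ <-] := mp_Mr _ _ _ Hu Hx Hx'.
  by rewrite mulgV; have [] := mp_1r _ Hu.
have ex u v : u \in Gp -> v \in Gp -> exists x0 y0,
   [/\ x0 \in Gm, y0 \in Gm, (R (u * x0, v * y0)%g != 0)%R &
     forall x y, x \in Gm -> y \in Gm -> (R (u * x, v * y)%g != 0)%R ->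
       x = x0 /\ y = y0].
  move=> Hu Hv.
  have : (t2mul Gp Gm R R' (u * 1, v * 1)%g != 0)%R.
    by rewrite RR' t2oneE // !eqxx delta_neq0.
  rewrite t2mulE // => /sum_neq0_ex[x0 [y0 [Hx0 Hy0]]].
  rewrite GRing.mulf_eq0 negb_or !mulg1 => /andP[N0 N1].
  exists x0, y0; split=> // x y Hx Hy N.
  have Hux := mp_ra _ _ Hu Hx0; have Hvy := mp_ra _ _ Hv Hy0.
  (* The arrow of [R'] returning along [(x0, y0)] is followed by the competing arrow [(x, y)]; the
     label of this composite must be trivial. *)
  have : (t2mul Gp Gm R' R (ra u x0 * (x0^-1 * x), ra v y0 * (y0^-1 * y))%g != 0)%R.
    rewrite t2mulE ?groupM ?groupV //; apply/eqP => S.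
    have S0 := sum_eq0_term _ x0^-1 y0^-1
      (fun x' y' => Num.Theory.mulr_ge0 (R'0 _) (R0 _)) S.
    move: S0; rewrite !groupV !rV // !mulKg => /(_ Hx0 Hy0) /eqP.
    by rewrite GRing.mulf_eq0 (negPf N1) (negPf N).
  rewrite R'R t2oneE ?groupM ?groupV // delta_neq0 -!eq_mulVg1.
  by case/andP => /eqP-> /eqP->.
exists (fun u v => (ab u v).1), (fun u v => (ab u v).2),
  (fun u v => R (u * (ab u v).1, v * (ab u v).2)).
have abP u v : u \in Gp -> v \in Gp -> P u v (ab u v).
  move=> Hu Hv; rewrite /ab; case: pickP => //= H.
  have [x [y [Hx Hy N _]]] := ex u v Hu Hv.
  by have := H (x, y); rewrite /P /= Hx Hy N.
split=> [u v Hu Hv | u v Hu Hv | u v | u v Hu Hv | u x v y Hu Hx Hv Hy].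
- by have /and3P[] := abP u v Hu Hv.
- by have /and3P[] := abP u v Hu Hv.
- exact: R0.
- by have /and3P[] := abP u v Hu Hv.
have /and3P[H1 H2 H3] := abP u v Hu Hv.
have [x0 [y0 [Hx0 Hy0 _ U]]] := ex u v Hu Hv.
have [/andP[/eqP-> /eqP->] | ne] := boolP ((x == (ab u v).1) && (y == (ab u v).2)).
  by rewrite /delta GRing.mulr1.
rewrite /delta GRing.mulr0; apply/eqP; apply: contraNT ne => N.
have [-> ->] := U _ _ H1 H2 H3.
by have [-> ->] := U _ _ Hx Hy N; rewrite !eqxx.
Qed.

(** * Item (i), necessity: recovering [xi] from a monomial [R] *)

Section Necessity.
Variables (R : {ffun gT * gT -> CC}) (a b : gT -> gT -> gT) (c : gT -> gT -> CC).
Hypothesis aG : forall u v, u \in Gp -> v \in Gp -> a u v \in Gm.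
Hypothesis bG : forall u v, u \in Gp -> v \in Gp -> b u v \in Gm.
Hypothesis c_ge0 : forall u v, (0 <= c u v)%R.
Hypothesis c_neq0 : forall u v, u \in Gp -> v \in Gp -> (c u v != 0)%R.
Hypothesis RE : forall u x v y, u \in Gp -> x \in Gm -> v \in Gp -> y \in Gm ->
  R (u * x, v * y) = (c u v * delta ((x == a u v) && (y == b u v)))%R.

Lemma eq_delta_neq0 (k r s : CC) (q : bool) : (k != 0)%R ->
  (k = r * (delta q * s))%R -> q /\ (k = r * s)%R.
Proof.
move=> N E; suff H : q by split; rewrite // E H /delta GRing.mul1r.
by apply: contraNT N => /negPf nq; rewrite E nq /delta GRing.mul0r GRing.mulr0.
Qed.

(** The axiom is read at the one basis element over [(u, v, w)] where the left side is the nonzero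
    [c (u * v) w]; every delta on the right must then hold. *)
Lemma coprod_id_cocycle : coprod_id Gp Gm R = t3mul Gp Gm (R13 Gp R) (R23 Gp R) ->
  forall u v w, u \in Gp -> v \in Gp -> w \in Gp ->
  [/\ la v (a (u * v) w) = a u w,
      b (u * v) w = b u w * b v (ra w (b u w)) &
      c (u * v) w = (c u w * c v (ra w (b u w)))%R].
Proof.
move=> H u v w Hu Hv Hw; have Huv : u * v \in Gp by rewrite groupM.
have Ha := aG _ _ Huv Hw; have Hb := bG _ _ Huv Hw; have Hbu := bG _ _ Hu Hw.
have := congr1 (fun f : {ffun _ -> CC} =>
  f (u * la v (a (u * v) w), v * a (u * v) w, w * b (u * v) w)) H.
rewrite coprod_idE ?mp_la // (R13_R23E _ _ _ _ aG bG RE) ?mp_la //.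
rewrite !RE ?(mp_ra, groupM, groupV) // !eqxx /= !delta1 !GRing.mulr1.
case/eq_delta_neq0; first exact: c_neq0.
move=> /eqP E1; rewrite [(c v _ * _)%R]GRing.mulrC => E.
have [/andP[_ /eqP E2] E3] := eq_delta_neq0 _ _ _ _ (c_neq0 _ _ Huv Hw) E.
by split=> //; rewrite -E2 mulKVg.
Qed.

Lemma id_coprod_cocycle : id_coprod Gp Gm R = t3mul Gp Gm (R13 Gp R) (R12 Gp R) ->
  forall u v w, u \in Gp -> v \in Gp -> w \in Gp ->
  a u (v * w) = a u w * a (ra u (a u w)) v /\ b u (v * w) = b u w.
Proof.
move=> H u v w Hu Hv Hw; have Hvw : v * w \in Gp by rewrite groupM.
have Ha := aG _ _ Hu Hvw; have Hb := bG _ _ Hu Hvw; have Hau := aG _ _ Hu Hw.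
have := congr1 (fun f : {ffun _ -> CC} =>
  f (u * a u (v * w), v * la w (b u (v * w)), w * b u (v * w))) H.
rewrite id_coprodE ?mp_la // (R13_R12E _ _ _ _ aG bG RE) ?mp_la //.
rewrite !RE ?(mp_ra, mp_la, groupM, groupV) // !eqxx /= !delta1 !GRing.mulr1.
case/eq_delta_neq0; first exact: c_neq0.
move=> /eqP E1; rewrite [(c _ v * _)%R]GRing.mulrC => E.
have [/andP[/eqP E2 _] _] := eq_delta_neq0 _ _ _ _ (c_neq0 _ _ Hu Hvw) E.
by split=> //; rewrite -E2 mulKVg.
Qed.

(** The test function [f] is the basis vector for which [R] followed by the coproduct has
    coefficient [c u v] at the chosen point. As this is nonzero, the only possible term on the other
    side, with labels [x] and [la u x], is present. *)
Lemma cocommutative_equivariance :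
  (forall f, t2mul Gp Gm (flip2 (hcoprod Gp Gm f)) R
             = t2mul Gp Gm R (hcoprod Gp Gm f)) ->
  forall u v x, u \in Gp -> v \in Gp -> x \in Gm ->
  [/\ v * u = ra u (a u v) * ra v (b u v),
      (la u x)^-1 * (b u v * x) = b (ra u x) (ra v (la u x)) &
      c u v = c (ra u x) (ra v (la u x))].
Proof.
move=> H u v x Hu Hv Hx.
have Ha := aG _ _ Hu Hv; have Hb := bG _ _ Hu Hv.
have Hua := mp_ra _ _ Hu Ha; have Hvb := mp_ra _ _ Hv Hb.
have Hl := mp_la _ _ Hvb Hx.
have Hy := mp_la _ _ Hu Hx; have Hux := mp_ra _ _ Hu Hx.
have Hvy := mp_ra _ _ Hv Hy.
pose m := a u v * la (ra v (b u v)) x; pose n := b u v * x.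
have Hm : m \in Gm by rewrite groupM.
have Hn : n \in Gm by rewrite groupM.
pose f : {ffun gT -> CC} := [ffun g => delta (g == ra u (a u v) * ra v (b u v) * x)].
have fE g : f g = delta (g == ra u (a u v) * ra v (b u v) * x) by rewrite ffunE.
have := congr1 (fun f : {ffun _ -> CC} => f (u * m, v * n)) (H f).
rewrite /= (t2mul_monomial _ _ _ _ aG bG RE) // hcoprodE ?(groupM, groupV) //.
rewrite !mulKg fE !eqxx !delta1 !GRing.mulr1 t2mulE //.
pose t := (v * u == ra u (a u v) * ra v (b u v)).
pose F x' y' := (c (ra u x') (ra v y') * delta (t &&
  ((x'^-1 * m == a (ra u x') (ra v y')) && (y'^-1 * n == b (ra u x') (ra v y')))%g))%R.
have -> : (\sum_(x' in Gm) \sum_(y' in Gm) flip2 (hcoprod Gp Gm f) (u * x', v * y')%g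
  * R (ra u x' * (x'^-1 * m), ra v y' * (y'^-1 * n))%g = F x (la u x))%R.
  rewrite -(sum_delta_in _ Gm (fun x' => F x' (la u x'))) //.
  apply: eq_bigr => x' Hx'; have Hy' := mp_la _ _ Hu Hx'.
  rewrite -(sum_delta_in _ Gm (F x') _ Hy') GRing.mulr_suml.
  apply: eq_bigr => y' Hy''; rewrite ffunE /= hcoprodE // fE.
  rewrite pm_eqE ?groupM // -/t RE ?(mp_ra, groupM, groupV) //.
  by rewrite /F !deltaM; ring.
rewrite /F GRing.mulrC -[delta _]GRing.mulr1 -GRing.mulrA => /esym E.
have {}E : c u v = (1 * (delta (t && ((x^-1 * m == a (ra u x) (ra v (la u x))) &&
    ((la u x)^-1 * n == b (ra u x) (ra v (la u x))))%g) * c (ra u x) (ra v (la u x))))%R.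
  by rewrite E; ring.
have [/and3P[/eqP E1 _ /eqP E2] E3] := eq_delta_neq0 _ _ _ _ (c_neq0 _ _ Hu Hv) E.
by split=> //; rewrite [LHS]E3 GRing.mul1r.
Qed.

Lemma prod_Gp_inj (h : gT -> gT) (F : gT -> CC) :
  {in Gp &, injective h} -> {in Gp, forall u, h u \in Gp} ->
  (\prod_(u in Gp) F (h u) = \prod_(u in Gp) F u)%R.
Proof.
move=> hI hG; rewrite -(big_imset F hI); apply: eq_bigl.
suff -> : h @: Gp = Gp by [].
apply/eqP; rewrite eqEcard card_in_imset // leqnn andbT.
by apply/subsetP => _ /imsetP[u Hu ->]; apply: hG.
Qed.

(* The product of c over its first argument is constant along the orbits of Gm
   by equivariance, so the cocycle identity turns c u w into a root of unity. *)
Lemma coef_eq1 :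
  (forall u v w, u \in Gp -> v \in Gp -> w \in Gp ->
    c (u * v) w = (c u w * c v (ra w (b u w)))%R) ->
  (forall u v x, u \in Gp -> v \in Gp -> x \in Gm ->
    c u v = c (ra u x) (ra v (la u x))) ->
  forall u w, u \in Gp -> w \in Gp -> c u w = 1%R.
Proof.
move=> cM cE u w Hu Hw.
pose N v := (\prod_(s in Gp) c s v)%R.
have NE y : y \in Gm -> N w = N (ra w y).
  move=> Hy; have Hy' : y^-1 \in Gm by rewrite groupV.
  rewrite -[RHS](prod_Gp_inj (pla y^-1)) => [|s t Hs Ht e|s Hs].
  - apply: eq_bigr => s Hs.
    have Hx : (pra y^-1 s)^-1 \in Gm by rewrite groupV pm_pra.
    (* This label acts so that [la] gives [y]: equivariance moves [w] to [ra w y] and permutes the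
       first arguments by [pla y^-1]. *)
    have e : s * (pra y^-1 s)^-1 = y * pla y^-1 s.
      by apply: (mulgI y^-1); rewrite mulKg mulgA (pm_swap y^-1 s) // mulgK.
    have [E1 E2] := mp_actE _ _ _ _ Hy (pm_pla _ _ Hy' Hs) e.
    by rewrite (cE s w _ Hs Hw Hx) E1 E2.
  - by rewrite -(pla_pla _ _ Hy Hs) e pla_pla.
  by rewrite pm_pla.
have Hb := bG _ _ Hu Hw.
have N0 : (N w != 0)%R by apply/GRing.prodf_neq0 => s Hs; apply: c_neq0.
have : N w = (c u w ^+ #|Gp| * N w)%R.
  rewrite {2}(NE _ Hb) /N -GRing.prodr_const -big_split /=.
  rewrite -(prod_Gp_inj (mulg u)) => [|s t _ _ /mulgI //|s Hs]; last exact: groupM.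
  by apply: eq_bigr => s Hs; apply: cM.
move/eqP; rewrite -{1}[N w]GRing.mul1r (inj_eq (GRing.mulIf N0)) eq_sym.
(* Non-negativity of [c] leaves 1 as the only root of unity. *)
by rewrite Num.Theory.pexpr_eq1 ?cardG_gt0 // => /eqP.
Qed.

Hypothesis invR : t2mul Gp Gm R (flip2 R) = t2one Gp.
Hypothesis coprod_idR :
  coprod_id Gp Gm R = t3mul Gp Gm (R13 Gp R) (R23 Gp R).
Hypothesis id_coprodR :
  id_coprod Gp Gm R = t3mul Gp Gm (R13 Gp R) (R12 Gp R).
Hypothesis cocommR : forall f, t2mul Gp Gm (flip2 (hcoprod Gp Gm f)) R
                               = t2mul Gp Gm R (hcoprod Gp Gm f).

Lemma necessity : exists xi : gT -> gT,
  [/\ grp_hom_on Gp Gm xi, abelian_normal_subgroup (A_xi Gp xi)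
    & R = R_of_xi Gp Gm xi].
Proof.
have C1 := coprod_id_cocycle coprod_idR.
have C2 := id_coprod_cocycle id_coprodR.
have C3 := cocommutative_equivariance cocommR.
have H1 : 1 \in Gp := group1 _.
have c1 : forall u w, u \in Gp -> w \in Gp -> c u w = 1%R.
  by apply: coef_eq1 => u v w Hu Hv Hw; [have [] := C1 u v w Hu Hv Hw
    | have [] := C3 u v w Hu Hv Hw].
(* Any second argument would do: the second coproduct axiom makes [b u] constant on [Gp]. *)
pose xi u := b u 1.
have bE u v : u \in Gp -> v \in Gp -> b u v = xi u.
  by move=> Hu Hv; have [_] := C2 u v 1 Hu Hv H1; rewrite mulg1.
have xG u : u \in Gp -> xi u \in Gm by move=> Hu; apply: bG.
have hxi : grp_hom_on Gp Gm xi.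
  split=> // u v Hu Hv; have [_ E _] := C1 u v 1 Hu Hv H1.
  by rewrite {1}/xi E (bE v) ?mp_ra ?bG.
(* The unit coefficient of [R] times its flip at [(u, v)] says that the flipped arrow undoes the
   labels of the original one. *)
have aV u v : u \in Gp -> v \in Gp -> (a u v)^-1 = xi (ra v (xi u)).
  move=> Hu Hv; have Ha := aG _ _ Hu Hv.
  have := congr1 (fun f : {ffun _ -> CC} => f (u * 1, v * 1)) invR.
  rewrite /= (t2mul_monomial _ _ _ _ aG bG RE) // t2oneE // !eqxx ffunE /= !mulg1.
  rewrite RE ?(mp_ra, groupV, bG) // !c1 ?(mp_ra, bG) // !GRing.mul1r => E.
  have : (delta (((b u v)^-1 == a (ra v (b u v)) (ra u (a u v))) &&
    ((a u v)^-1 == b (ra v (b u v)) (ra u (a u v))))%g != 0)%R by rewrite E delta_neq0.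
  by rewrite delta_neq0 => /andP[_ /eqP->]; rewrite !bE ?(mp_ra, bG).
have a1 w : w \in Gp -> a 1 w = (xi w)^-1.
  move=> Hw; apply: invg_inj; rewrite aV // (xi1 xi) // invgK.
  by have [_ ->] := mp_1r _ Hw.
have lavE v w : v \in Gp -> w \in Gp -> la v (a v w) = (xi w)^-1.
  by move=> Hv Hw; have [] := C1 1 v w H1 Hv Hw; rewrite mul1g a1.
have pmE v w : v \in Gp -> w \in Gp ->
    pla (xi w) v = ra v (a v w) /\ pra (xi w) v = (a v w)^-1.
  move=> Hv Hw; have Ha := aG _ _ Hv Hw.
  apply: pm_actE; rewrite ?groupV ?mp_ra //.
  by apply: (mulIg (a v w)); rewrite mulgKV -mulgA (mp_swap v (a v w)) // lavE // mulKVg.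
have mc : matched_condition Gp Gm xi.
  move=> u v x Hu Hv Hx; split.
    have [E _ _] := C3 v u 1 Hv Hu (group1 _).
    by rewrite E bE //; have [<- _] := pmE v u Hv Hu.
  have Hl := pm_pla _ _ Hx Hu; have Hr := pm_pra _ _ Hx Hu.
  (* Equivariance is applied at the far end of the square [x * u = pla x u * pra x u], where [la]
     and [ra] return [x] and [u]. *)
  have [_ E _] := C3 (pla x u) 1 (pra x u) Hl H1 Hr.
  have [E1 E2] := mp_actE (pla x u) (pra x u) x u Hx Hu (esym (pm_swap _ _ Hx Hu)).
  by move: E; rewrite E1 E2 !bE ?mp_ra // => <-; rewrite mulKVg.
exists xi; split=> //; first exact: matched_abelian_normal.
apply: ffun2_pm => u m v n Hu Hm Hv Hn; rewrite RE // R_of_xiE // c1 // bE //.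
by have [_ ->] := pmE u v Hu Hv; rewrite invgK.
Qed.
End Necessity.
End MatchedPair.

Theorem theorem4 :
  (* (i) *)
  (forall (gT : finGroupType) (Gp Gm : {group gT}),
     unique_factorization Gp Gm ->
     (forall R : {ffun gT * gT -> CC},
        positive R /\ triangular Gp Gm R <->
        exists xi : gT -> gT,
          [/\ grp_hom_on Gp Gm xi, abelian_normal_subgroup (A_xi Gp xi)
            & R = R_of_xi Gp Gm xi]) /\
     (forall xi1 xi2 : gT -> gT,
        grp_hom_on Gp Gm xi1 -> abelian_normal_subgroup (A_xi Gp xi1) ->
        grp_hom_on Gp Gm xi2 -> abelian_normal_subgroup (A_xi Gp xi2) ->
        R_of_xi Gp Gm xi1 = R_of_xi Gp Gm xi2 -> {in Gp, xi1 =1 xi2})) /\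
  (* (ii) *)
  (forall (gT : finGroupType) (Gp Gm : {group gT}) (xi : gT -> gT),
     unique_factorization Gp Gm -> grp_hom_on Gp Gm xi ->
     (abelian_normal_subgroup (A_xi Gp xi) <-> matched_condition Gp Gm xi)) /\
  (* (iii) *)
  (* pair -> triple is well defined *)
  (forall (gT : finGroupType) (Gp Gm : {group gT}) (xi : gT -> gT),
     good_pair Gp Gm xi ->
     forall A : {group gT}, (A : {set gT}) = A_xi Gp xi ->
       abelian A /\
       (exists to : groupAction Gm A, {in A & Gm, forall a x, to a x = (a ^ x)%g}) /\
       (exists zeta : gT -> gT,
          [/\ {in Gp, forall u, zeta (u * xi u^-1)%g = xi u},
              {in A, forall a, zeta a \in Gm} &
              {in A &, forall a b, (zeta a * zeta b)%g
                                   = zeta (a * (zeta a * b * (zeta a)^-1))%g}])) /\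
  (* triple -> pair is well defined *)
  (forall (xT rT : finGroupType) (Gm : {group xT}) (A : {group rT})
          (to : groupAction Gm A) (zeta : rT -> xT),
     good_triple to zeta ->
     group_set (sdGp to zeta) /\ good_pair (sdGp to zeta) (sdGm to) (sdP to)) /\
  (* pair -> triple -> pair is the identity, via (a, x) |-> a x *)
  (forall (gT : finGroupType) (Gp Gm : {group gT}) (xi : gT -> gT),
     good_pair Gp Gm xi ->
     forall (A : {group gT}) (to : groupAction Gm A) (zeta : gT -> gT),
       (A : {set gT}) = A_xi Gp xi ->
       {in A & Gm, forall a x, to a x = (a ^ x)%g} ->
       {in Gp, forall u, zeta (u * xi u^-1)%g = xi u} ->
       exists phi : sdprod_by to -> gT,
         [/\ {morph phi : w1 w2 / (w1 * w2)%g} /\ bijective phi,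
             {in A & Gm, forall a x, phi (sdpair1 to a * sdpair2 to x)%g = (a * x)%g},
             phi @: sdGp to zeta = Gp, phi @: sdGm to = Gm &
             {in sdGp to zeta, forall w, phi (sdP to w) = xi (phi w)}]) /\
  (* triple -> pair -> triple is the identity, via sdpair1 on A, sdpair2 on G- *)
  (forall (xT rT : finGroupType) (Gm : {group xT}) (A : {group rT})
          (to : groupAction Gm A) (zeta : rT -> xT),
     good_triple to zeta ->
     [/\ A_xi (sdGp to zeta) (sdP to) = [set sdpair1 to a | a in A],
         {in A & Gm, forall a x, sdpair1 to (ldot to x a)
                                 = (sdpair2 to x * sdpair1 to a * (sdpair2 to x)^-1)%g} &
         forall zeta' : sdprod_by to -> sdprod_by to,
           {in sdGp to zeta, forall u, zeta' (u * sdP to u^-1)%g = sdP to u} ->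
           {in A, forall a, zeta' (sdpair1 to a) = sdpair2 to (zeta a)}]).
Proof.
split.
  move=> gT Gp Gm uf; split=> [R|xi1 xi2 h1 an1 h2 an2 E u Hu]; first split.
  - case=> posR [[[Ri [RRi RiR coc]] cid idc _ _] tri].
    (* Triangularity makes the flip of [R] its inverse, so the inverse is non-negative too. *)
    have pos' : positive (flip2 R) by move=> p; rewrite ffunE; apply: posR.
    have inv : t2mul Gp Gm R (flip2 R) = t2one Gp.
      by rewrite -{1}[R]flip2K -(flip2M gT Gp Gm uf) tri flip2_1.
    have [a [b [c [aG bG c0 cn0 RE]]]] :=
      positive_invertible_monomial gT Gp Gm uf R (flip2 R) posR pos' inv tri.
    apply: (necessity gT Gp Gm uf R a b c aG bG c0 cn0 RE inv cid idc) => f.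
    by apply/(cocommE gT Gp Gm uf R Ri RRi RiR).
  - case=> xi [hxi an ->]; split; first exact: R_of_xi_positive.
    by apply: R_of_xi_triangular => //; apply: abelian_normal_matched.
  have H1 : (1 \in Gp)%g := group1 _.
  have x1 := h1.2 u Hu; have p1 : (pm_ract Gp Gm (xi1 1) u)^-1%g \in Gm.
    by rewrite groupV pm_pra // h1.2.
  (* The arrow of the first structure out of [(u, 1)] has second label [xi1 u]; it must also be the
     arrow of the second structure. *)
  have := congr1 (fun f : {ffun _ -> CC} =>
    f (u * (pm_ract Gp Gm (xi1 1) u)^-1, 1 * xi1 u)%g) E.
  rewrite /= !(R_of_xiE gT Gp Gm uf) // !eqxx !GRing.mul1r => E'.
  have : (delta true != 0)%R by rewrite delta_neq0.
  by rewrite E' delta_neq0 => /andP[_ /eqP].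
split.
  move=> gT Gp Gm xi uf hxi; split.
    exact: abelian_normal_matched.
  exact: matched_abelian_normal.
split.
  move=> gT Gp Gm xi [uf hxi an] A defA; split; last split.
  - by rewrite defA; case/and3P: an.
  - exact: xi_action an A defA.
  exact: xi_cocycle defA.
split.
  move=> xT rT Gm A to zeta gt; split; first exact: sdGp_group.
  exact: sd_good_pair.
split.
  move=> gT Gp Gm xi [uf hxi an] A to zeta defA toE zetaE.
  exact: sd_iso defA _ _ toE zetaE.
move=> xT rT Gm A to zeta gt; split.
- exact: A_xi_sd.
- exact: sdpair1_ldot.
exact: sd_zeta.
Qed.
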